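(* Let $0=t_0<t_1<\cdots<t_N=T$ with $N\ge1$. Assume that: (1) a state reduction $\big(\{\mathbb{X}_{t_i}\}_{0\le i\le N},\{\theta_{t_i}\}_{0\le i\le N},\{f_{t_i:t_{i+1}}\}_{0\le i\le N-1}\big)$ exists across the consecutive time blocks $\{t_i,\dots,t_{i+1}\}$, $i=0,\dots,N-1$, and it is compatible with the stochastic kernels $\{\rho_{s-1:s}\}_{1\le s\le T}$, with reduced kernels $\tilde\rho$; (2) the noises are exogenous and time block independent: for all $0\le i\le N-1$ and $t_i\le r<t_{i+1}$, the kernel $\rho_{r:r+1}$ depends on the history $h_r$ only through $(w_{t_i},\dots,w_r)$, that is, it is of the form $\rho_{r:r+1}:\mathbb{W}_{t_i}\times\cdots\times\mathbb{W}_r\to\Delta(\mathbb{W}_{r+1})$; (3) the cost criterion is $j(h_T)=\sum_{i=0}^{N-1}\ell_{t_i}\big(\theta_{t_i}(h_{t_i}),h_{t_i+1:t_{i+1}}\big)+\ell_{t_N}\big(\theta_{t_N}(h_{t_N})\big)$, where $\ell_{t_i}:\mathbb{X}_{t_i}\times\mathbb{H}_{t_i+1:t_{i+1}}\to[0,+\infty]$ ($0\le i\le N-1$) and $\ell_{t_N}:\mathbb{X}_{t_N}\to[0,+\infty]$ are lower semianalytic. Define $\tilde V_{t_N}=\ell_{t_N}$ and, backward for $i=N-1,\dots,0$ and every $x\in\mathbb{X}_{t_i}$, writing $r=t_i$, $t=t_{i+1}$, define $\tilde V_{t_i}(x)$ as the nested sequence of infima of integrals $$\tilde V_{t_i}(x)=\inf_{u_r\in\mathbb{U}_r}\int_{\mathbb{W}_{r+1}}\rho_{r:r+1}(dw_{r+1}\mid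 w_r)\ \inf_{u_{r+1}\in\mathbb{U}_{r+1}}\int_{\mathbb{W}_{r+2}}\rho_{r+1:r+2}(dw_{r+2}\mid w_r,w_{r+1})\cdots\inf_{u_{t-1}\in\mathbb{U}_{t-1}}\int_{\mathbb{W}_t}\rho_{t-1:t}(dw_t\mid w_r,\dots,w_{t-1})$$ $$\Big(\ell_r(x,u_r,w_{r+1},\dots,u_{t-1},w_t)+\tilde V_{t_{i+1}}\big(f_{r:t}(x,u_r,w_{r+1},\dots,u_{t-1},w_t)\big)\Big),$$ where the kernels $\rho_{s-1:s}(dw_s\mid w_r,\dots,w_{s-1})$ are understood as the reduced kernels $\tilde\rho_{s-1:s}(dw_s\mid x,u_r,w_{r+1},\dots,u_{s-2},w_{s-1})$; when $x=\theta_{t_i}(h_{t_i})$ these coincide with the kernels as displayed, $w_r=w_{t_i}$ being the last component of $h_{t_i}$. Then the value $V_0(w_0)=\inf_{\gamma\in\Gamma_{0:T-1}}\int_{\mathbb{H}_T}j(h'_T)\,\rho^\gamma_{0:T}(dh'_T\mid w_0)$ of the multistage stochastic optimization problem is given by $$V_0(w_0)=\tilde V_{t_0}\big(\theta_{t_0}(w_0)\big),\qquad w_0\in\mathbb{W}_0 .$$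
   Context: Setting. $T\ge1$ is an integer. Borel space: a Borel subset of a Polish space (up to homeomorphism) with its Borel $\sigma$-field. $\Delta(\mathbb Y)$ is the Borel space of probability measures on a Borel space $\mathbb Y$. A function $\varphi:\mathbb{X}\to[0,+\infty]$ on a Borel space is lower semianalytic if $\{\varphi<c\}$ is an analytic set for every $c\in\mathbb{R}$. A map between Borel spaces is universally measurable if preimages of Borel sets belong to the universal $\sigma$-field (the intersection of the completions of the Borel $\sigma$-field under all Borel probability measures). Integrals of universally measurable functions are taken with respect to completed measures; $\inf\emptyset=+\infty$. Histories. $\mathbb{U}_t$ ($0\le t\le T-1$) and $\mathbb{W}_t$ ($0\le t\le T$) are Borel spaces (controls, uncertainties). $\mathbb{H}_t=\mathbb{W}_0\times\prod_{s=1}^t(\mathbb{U}_{s-1}\times\mathbb{W}_s)$, with elements $h_t=(w_0,u_0,w_1,\dots,u_{t-1},w_t)$; $\mathbb{H}_{r:s}=\prod_{\tau=r}^s(\mathbb{U}_{\tau-1}\times\mathbb{W}_\tau)$ with elements $h_{r:s}=(u_{r-1},w_r,\dots,u_{s-1},w_s)$, so $h_t=(h_{r},h_{r+1:t})$; sub-histories $h_s$, $h_{r:s}$ of $h_T$ are the corresponding components. For $1\le t\le T$, $\rho_{t-1:t}:\mathbb{H}_{t-1}\to\Delta(\mathbb{W}_t)$ is a Borel-measurable stochastic kernel, written $\rho_{t-1:t}(dw_t\mid h_{t-1})$. $\Gamma_{t:T-1}$ is the set of sequences $\gamma=(\gamma_s)_{t\le s\le T-1}$ of universally measurable maps $\gamma_s:\mathbb{H}_s\to\mathbb{U}_s$.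 For $\gamma\in\Gamma_{t:T-1}$ and $h_t\in\mathbb{H}_t$, $\rho^\gamma_{t:T}(\cdot\mid h_t)\in\Delta(\mathbb{H}_T)$ is the law of the history $h_T$ obtained from $h_t$ by $u_s=\gamma_s(h_s)$, $w_{s+1}\sim\rho_{s:s+1}(\cdot\mid h_s)$, $h_{s+1}=(h_s,u_s,w_{s+1})$, $s=t,\dots,T-1$. State reduction. The family $\big(\{\mathbb{X}_{t_i}\},\{\theta_{t_i}\},\{f_{t_i:t_{i+1}}\}\big)$ consists of Borel spaces $\mathbb{X}_{t_i}$, Borel-measurable maps $\theta_{t_i}:\mathbb{H}_{t_i}\to\mathbb{X}_{t_i}$, and Borel-measurable maps $f_{t_i:t_{i+1}}:\mathbb{X}_{t_i}\times\mathbb{H}_{t_i+1:t_{i+1}}\to\mathbb{X}_{t_{i+1}}$. It is a state reduction across the consecutive time blocks if, for all $i=0,\dots,N-1$ and all $h_{t_{i+1}}=(h_{t_i},h_{t_i+1:t_{i+1}})\in\mathbb{H}_{t_{i+1}}$, $\theta_{t_{i+1}}(h_{t_{i+1}})=f_{t_i:t_{i+1}}(\theta_{t_i}(h_{t_i}),h_{t_i+1:t_{i+1}})$. It is compatible with the kernels if for every $i=0,\dots,N-1$ there are Borel-measurable reduced kernels $\tilde\rho_{t_i:t_i+1}:\mathbb{X}_{t_i}\to\Delta(\mathbb{W}_{t_i+1})$ and $\tilde\rho_{s-1:s}:\mathbb{X}_{t_i}\times\mathbb{H}_{t_i+1:s-1}\to\Delta(\mathbb{W}_s)$ for $t_i+2\le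 s\le t_{i+1}$, with $\rho_{t_i:t_i+1}(dw\mid h_{t_i})=\tilde\rho_{t_i:t_i+1}(dw\mid\theta_{t_i}(h_{t_i}))$ and $\rho_{s-1:s}(dw\mid (h_{t_i},h_{t_i+1:s-1}))=\tilde\rho_{s-1:s}(dw\mid\theta_{t_i}(h_{t_i}),h_{t_i+1:s-1})$ for all histories. *)

(* Defs.v *)
From HB Require Import structures.
From mathcomp Require Import all_boot all_order all_algebra.
From mathcomp Require Import all_classical all_reals all_analysis.
From mathcomp Require Import measurable_realfun.

Set Implicit Arguments.
Unset Strict Implicit.
Unset Printing Implicit Defensive.
Import Order.TTheory GRing.Theory Num.Theory.

Local Open Scope classical_set_scope.
Local Open Scope ring_scope.
Local Open Scope ereal_scope.

Definition polish (R : realType) (Y : completePseudoMetricType R) : Prop :=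
  hausdorff_space Y /\ exists2 D : set Y, countable D & dense D.

(* [f] is a bijection of [T] onto a Borel subset of a Polish space; it carries
   the trace topology back to [T], and the condition on [measurable] says that
   the sigma-field of [T] is the Borel one.  A [measurableType] is pointed, so
   Borel spaces are nonempty here. *)
Definition borel_space (R : realType) d (T : measurableType d) : Prop :=
  exists (Y : completePseudoMetricType R) (f : T -> Y),
    [/\ polish Y, injective f, <<s open >> (range f) &
        forall A : set T, measurable A <->
          exists2 B : set Y, <<s open >> B & A = f @^-1` B].
Arguments borel_space R {d} T.

(* Analytic sets as Borel images of Borel subsets of Borel spaces. *)
Definition analytic (R : realType) d (X : measurableType d) (A : set X) : Prop :=
  exists (d' : measure_display) (Y : measurableType d') (B : set Y) (f : Y -> X),
    [/\ borel_space R Y, measurable B, measurable_fun setT f & A = f @` B].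
Arguments analytic R {d X} A.

Definition lower_semianalytic (R : realType) d (X : measurableType d)
    (phi : X -> \bar R) : Prop :=
  forall c : R, analytic R [set x | phi x < c%:E].

Definition completion (R : realType) d (T : measurableType d)
    (P : {measure set T -> \bar R}) : set (set T) :=
  [set A | exists2 B, measurable B & P.-negligible (A `+` B)].

Definition universally_measurable (R : realType) d (T : measurableType d) :
    set (set T) :=
  [set A | forall P : probability T R, completion P A].
Arguments universally_measurable R {d T} _.

Record umfun (R : realType) d d' (X : measurableType d) (Y : measurableType d') :=
  UMFun {
    umfun_val :> X -> Y ;
    umfunP : forall B : set Y, measurable B ->
      universally_measurable R (umfun_val @^-1` B) }.
Arguments umfun R {d d'} X Y.

Section completed_integral.
Context (R : realType) d (T : measurableType d).

Lemma caratheodory_of_measurable (P : {measure set T -> \bar R}) (A : set T) :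
  measurable A -> (P^*)%mu.-cara.-measurable A.
Proof. by move=> mA; apply: sub_caratheodory; apply: sub_sigma_algebra. Qed.

Lemma completion_caratheodory (P : {measure set T -> \bar R}) (A : set T) :
  completion P A -> (P^*)%mu.-cara.-measurable A.
Proof.
move=> [B mB [M [mM PM0 AB]]].
have mB' := caratheodory_of_measurable P mB.
have mN : (P^*)%mu.-cara.-measurable (A `+` B).
  apply: measure_is_complete_caratheodory; exists M; split => //.
    exact: caratheodory_of_measurable.
  by rewrite -PM0; exact: measurable_mu_extE.
rewrite (_ : A = (B `\` (A `+` B)) `|` ((A `+` B) `\` B)).
  by apply: measurableU; apply: measurableD.
apply/seteqP; split => x.
  have [xB|xB] := pselect (B x) => xA.
    by left; split => // -[[]|[]].
  by right; split => //; left.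
move=> [[xB /= nAB]|[[[//]|[//]]]].
by apply: contrapT => nA; apply: nAB; right.
Qed.

Lemma mu_ext_hull (P : {measure set T -> \bar R}) (A : set T) :
  (P^*)%mu A < +oo -> exists B, [/\ measurable B, A `<=` B & P B = (P^*)%mu A].
Proof.
move=> Afin.
have PAfin : (P^*)%mu A \is a fin_num by rewrite ge0_fin_numE// mu_ext_ge0.
have /choice[F HF] : forall k : nat, exists B, [/\ measurable B, A `<=` B &
    P B <= (P^*)%mu A + (k.+1%:R^-1)%:E].
  move=> k.
  have k0 : (0 < (k.+1%:R : R)^-1)%R by rewrite invr_gt0.
  have [_ [G [mG AG] <-] GA] := lb_ereal_inf_adherent k0 PAfin.
  have mUG : measurable (\bigcup_i G i) by exact: bigcupT_measurable.
  exists (\bigcup_i G i); split => //.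
  by apply: le_trans (ltW GA); apply: measure_sigma_subadditive.
exists (\bigcap_i F i); split.
- by apply: bigcapT_measurable => i; have [] := HF i.
- by move=> x Ax i _; have [_ + _] := HF i; apply.
- apply/eqP; rewrite eq_le; apply/andP; split.
    apply/lee_addgt0Pr => e e0.
    have [k ke] : exists k : nat, (k.+1%:R^-1 < e)%R.
      by have [k] := ltr_add_invr e0; rewrite add0r => ke; exists k.
    have [mF AF PF] := HF k.
    apply: (@le_trans _ _ (P (F k))).
      apply: le_measure; rewrite ?inE//; first by apply: bigcapT_measurable => i; have [] := HF i.
      by apply: bigcap_inf.
    apply: (le_trans PF); rewrite leeD2l// lee_fin; exact: ltW.
  rewrite -measurable_mu_extE; last by apply: bigcapT_measurable => i; have [] := HF i.
  apply: le_outer_measure => x Ax i _; have [_ + _] := HF i; exact.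
Qed.

Lemma completionE (P : probability T R) (A : set T) :
  completion P A <-> (P^*)%mu.-cara.-measurable A.
Proof.
split; first exact: completion_caratheodory.
have Pfin (X : set T) : (P^*)%mu X < +oo.
  apply: (@le_lt_trans _ _ ((P^*)%mu setT)); first exact: le_outer_measure.
  rewrite (_ : (P^*)%mu setT = 1) ?ltey//.
  by rewrite measurable_mu_extE//; exact: probability_setT.
move=> mA; have [B [mB AB PB]] := mu_ext_hull (Pfin A).
have [M [mM BAM PM]] := mu_ext_hull (Pfin (B `\` A)).
exists B => //; exists M; split => //; last first.
  apply: subset_trans BAM => x -[[/AB]|] //.
rewrite PM.
have : (P^*)%mu B = (P^*)%mu A + (P^*)%mu (B `\` A).
  have -> : (P^*)%mu A = (P^*)%mu (B `&` A) by rewrite setIidr.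
  exact: mA.
rewrite [LHS]measurable_mu_extE// PB.
have PAfin : (P^*)%mu A \is a fin_num by rewrite ge0_fin_numE// mu_ext_ge0.
move=> /(congr1 (fun z => z - (P^*)%mu A)).
by rewrite subee// addeAC subee// add0e => <-.
Qed.
End completed_integral.

(* For a probability measure, the sigma-field of [completed_measure_extension]
   is the completion of the Borel one, by [completionE]. *)
Definition cintegral (R : realType) d (T : measurableType d)
    (mu : {measure set T -> \bar R}) (f : T -> \bar R) : \bar R :=
  \int[@completed_measure_extension _ _ _ mu]_x f x.

Section step_law.
Context (R : realType) d dU dW (H : measurableType d) (U : measurableType dU)
  (W : measurableType dW).
Variables (P : probability H R) (rho : R.-pker H ~> W) (g : umfun R H U).

Let kfst (hu : H * U) : {measure set W -> \bar R} := rho hu.1.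

Let measurable_kfst (B : set W) : measurable B ->
  measurable_fun [set: H * U] (kfst ^~ B).
Proof.
move=> mB.
exact: (measurableT_comp (measurable_kernel rho _ mB) (@measurable_fst _ _ H U)).
Qed.

HB.instance Definition _ := isKernel.Build _ _ _ _ _ kfst measurable_kfst.

Let prob_kfst hu : kfst hu setT = 1. Proof. exact: prob_kernel. Qed.

HB.instance Definition _ := Kernel_isProbability.Build _ _ _ _ _ kfst prob_kfst.

(* If the history h has law [P], this is the law of (h, g h, w), where w has
   conditional law [rho h]. *)
Definition step_law (A : set (H * (U * W))) : \bar R :=
  cintegral P (fun h => rho h [set w | A (h, (g h, w))]).

Let CH := caratheodory_type (P^*)%mu.

Let measurable_graph : measurable_fun (setT : set CH) (fun h : CH => (h : H, g h)).
Proof.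
apply/measurable_fun_pairP; split.
  move=> _ B mB; rewrite setTI.
  exact: caratheodory_of_measurable.
move=> _ B mB; rewrite setTI.
by apply/completionE; exact: umfunP.
Qed.

Let measurable_section (A : set (H * (U * W))) : measurable A ->
  measurable_fun (setT : set CH) (fun h : CH => rho h [set w | A (h, (g h, w))]).
Proof.
move=> mA; pose A' : set ((H * U) * W) := [set p | A (p.1.1, (p.1.2, p.2))].
have mA' : measurable A'.
  have mf : measurable_fun setT
      (fun p : (H * U) * W => (p.1.1, (p.1.2, p.2))).
    have m1 := @measurable_fst _ _ (H * U)%type W.
    apply/measurable_fun_pairP; split => /=.
      exact: (measurableT_comp (@measurable_fst _ _ H U) m1).
    apply/measurable_fun_pairP; split => /=.
      exact: (measurableT_comp (@measurable_snd _ _ H U) m1).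
    exact: (@measurable_snd _ _ (H * U)%type W).
  by have := mf measurableT _ mA; rewrite setTI.
have := @measurable_fun_xsection_finite_kernel _ _ _ _ R kfst A'.
rewrite inE => /(_ mA') mphi.
have := measurableT_comp mphi measurable_graph.
apply: eq_measurable_fun => h _ /=; congr (rho h _).
by apply/seteqP; split => w; rewrite /xsection/= inE.
Qed.

Let msec (A : set (H * (U * W))) h : measurable A ->
  measurable [set w | A (h, (g h, w))].
Proof.
move=> mA.
have mf : measurable_fun setT (fun w : W => (h, (g h, w))).
  apply/measurable_fun_pairP; split; first exact: measurable_cst.
  apply/measurable_fun_pairP; split; first exact: measurable_cst.
  exact: measurable_id.
by have := mf measurableT _ mA; rewrite setTI.
Qed.

Let step_law0 : step_law set0 = 0.
Proof.
rewrite /step_law /cintegral integral0_eq// => h _.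
by rewrite (_ : [set w | _] = set0) ?measure0//; apply/seteqP; split.
Qed.

Let step_law_ge0 A : 0 <= step_law A.
Proof. by apply: integral_ge0 => h _; exact: measure_ge0. Qed.

Let step_law_sigma_additive : semi_sigma_additive step_law.
Proof.
move=> F mF tF mUF.
have -> : step_law (\bigcup_i F i) = \sum_(i <oo) step_law (F i).
  rewrite /step_law /cintegral.
  rewrite -integral_nneseries//; last by move=> i; exact: measurable_section.
  apply: eq_integral => h _.
  have -> : [set w | (\bigcup_i F i) (h, (g h, w))] =
            \bigcup_i [set w | F i (h, (g h, w))] by [].
  apply: measure_semi_bigcup.
  - by move=> i; exact: msec.
  - apply/trivIsetP => i j _ _ ij; apply/seteqP; split => // w [/= Fi Fj].
    have /trivIsetP /(_ i j Logic.I Logic.I ij) := tF.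
    by rewrite -subset0 => /(_ (h, (g h, w))); apply.
  - by apply: bigcupT_measurable => i; exact: msec.
by apply: is_cvg_nneseries => i _ _; exact: step_law_ge0.
Qed.

HB.instance Definition _ := isMeasure.Build _ _ _ step_law
  step_law0 step_law_ge0 step_law_sigma_additive.

Let step_lawT : step_law setT = 1.
Proof.
rewrite /step_law /cintegral.
rewrite (eq_integral (cst 1)); last first.
  by move=> h _; exact: prob_kernel.
rewrite integral_cst// mul1e.
rewrite /completed_measure_extension.
rewrite [LHS]measurable_mu_extE//; exact: probability_setT.
Qed.

HB.instance Definition _ := Measure_isProbability.Build _ _ _ step_law step_lawT.

End step_law.

Section histories.
Local Open Scope nat_scope.
Context (dU dW : nat -> measure_display).
Variables (U : forall t, measurableType (dU t))
  (W : forall t, measurableType (dW t)).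

Fixpoint hist_display (t : nat) : measure_display :=
  if t is s.+1 then measure_prod_display
    (hist_display s, measure_prod_display (dU s, dW s.+1)) else dW 0.

Fixpoint hist (t : nat) : measurableType (hist_display t) :=
  match t with
  | 0 => W 0
  | s.+1 => (hist s * (U s * W s.+1))%type
  end.

(* [seg r k] is the space of the (u_r, w_(r+1), ..., u_(r+k-1), w_(r+k)).
   Writing [k + r] for the end time makes [hist (k.+1 + r)] convertible to
   [hist (k + r) * (U (k + r) * W (k + r).+1)]. *)
Fixpoint seg_display (r k : nat) : measure_display :=
  if k is k'.+1 then measure_prod_display
    (seg_display r k', measure_prod_display (dU (k' + r), dW (k' + r).+1))
  else default_measure_display.

Fixpoint seg (r k : nat) : measurableType (seg_display r k) :=
  match k with
  | 0 => unit
  | k'.+1 => (seg r k' * (U (k' + r) * W (k' + r).+1))%type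
  end.

(* The components h_r and h_(r+1:r+k) of a history of length r+k. *)
Fixpoint hpre (r k : nat) : hist (k + r) -> hist r :=
  match k return hist (k + r) -> hist r with
  | 0 => fun h => h
  | k'.+1 => fun h => hpre h.1
  end.

Fixpoint hseg (r k : nat) : hist (k + r) -> seg r k :=
  match k return hist (k + r) -> seg r k with
  | 0 => fun=> tt
  | k'.+1 => fun h => (hseg h.1, h.2)
  end.

Fixpoint last_noise (t : nat) : hist t -> W t :=
  match t return hist t -> W t with
  | 0 => fun h => h
  | s.+1 => fun h => h.2.2
  end.

(* [noises r k] is the space of the (w_r, ..., w_(r+k)). *)
Fixpoint noises_display (r k : nat) : measure_display :=
  if k is k'.+1 then measure_prod_display
    (noises_display r k', dW (k' + r).+1) else dW r.

Fixpoint noises (r k : nat) : measurableType (noises_display r k) :=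
  match k with
  | 0 => W r
  | k'.+1 => (noises r k' * W (k' + r).+1)%type
  end.

Fixpoint hnoise (r k : nat) : hist (k + r) -> noises r k :=
  match k return hist (k + r) -> noises r k with
  | 0 => @last_noise r
  | k'.+1 => fun h => (hnoise h.1, h.2.2)
  end.

Section laws.
Variable R : realType.

(* Only the maps gamma_s with s < T matter below (all the spaces U_s being
   nonempty, those with s >= T always exist); the families [U], [W], [rho] are
   likewise indexed by all of [nat], and irrelevant past the horizon. *)
Definition policy := forall s : nat, umfun R (hist s) (U s).

Variable rho : forall t, R.-pker (hist t) ~> (W t.+1).

(* The law of the history at time t started from [w0] and driven by [gamma];
   it uses only gamma_s for s < t. *)
Fixpoint hist_law (gamma : policy) (w0 : W 0) (t : nat) :
    probability (hist t) R :=
  match t return probability (hist t) R with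
  | 0 => dirac w0
  | s.+1 => step_law (hist_law gamma w0 s) (rho s) (gamma s)
  end.

Definition value (T : nat) (j : hist T -> \bar R) (w0 : W 0) : \bar R :=
  ereal_inf [set cintegral (hist_law gamma w0 T) j | gamma in [set: policy]].

End laws.

End histories.

Arguments hpre {dU dW U W} r k h.
Arguments hseg {dU dW U W} r k h.
Arguments hnoise {dU dW U W} r k h.
Arguments value {dU dW U W R} rho {T} j w0.

(* The time grid with block lengths [n 0], [n 1], etc.  The sub-histories and
   segments of histories then typecheck without casts, and [gridP] says that
   every increasing grid starting at 0 has this form. *)
Fixpoint grid (n : nat -> nat) (i : nat) : nat :=
  if i is i'.+1 then (n i' + grid n i')%N else 0%N.

Lemma gridP (N : nat) (t : nat -> nat) :
  t 0%N = 0%N -> (forall i, (i < N)%N -> (t i < t i.+1)%N) ->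
  exists n : nat -> nat,
    (forall i, (i < N)%N -> (0 < n i)%N) /\
    (forall i, (i <= N)%N -> grid n i = t i).
Proof.
move=> t0 tlt; exists (fun i => (t i.+1 - t i)%N); split.
  by move=> i iN; rewrite subn_gt0 tlt.
elim => [|i IH] iN /=; first by rewrite t0.
by rewrite IH ?subnK ?(ltnW iN)// ltnW// tlt.
Qed.

Section reduction.
Context (dU dW dX : nat -> measure_display).
Variables (U : forall t, measurableType (dU t))
  (W : forall t, measurableType (dW t)) (X : forall i, measurableType (dX i)).
Variable R : realType.
Variables (N : nat) (n : nat -> nat).
Let t_ := grid n.
Variables (rho : forall t, R.-pker (hist U W t) ~> (W t.+1))
  (theta : forall i, hist U W (t_ i) -> X i)
  (f : forall i, X i * seg U W (t_ i) (n i) -> X i.+1)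
  (rhot : forall i k, R.-pker (X i * seg U W (t_ i) k) ~> (W (k + t_ i).+1)).
Arguments theta : clear implicits.
Arguments f : clear implicits.

Definition state_reduction : Prop :=
  [/\ forall i, (i <= N)%N -> borel_space R (X i),
      forall i, (i <= N)%N -> measurable_fun setT (theta i),
      forall i, (i < N)%N -> measurable_fun setT (f i) &
      forall i, (i < N)%N -> forall h : hist U W (t_ i.+1),
        theta i.+1 h = f i (theta i (hpre (t_ i) (n i) h), hseg (t_ i) (n i) h)].

(* For k = 0, [seg _ _ 0] is a one-point space: [rhot i 0] is a kernel from
   [X i]. *)
Definition compatible : Prop :=
  forall i k, (i < N)%N -> (k < n i)%N ->
  forall (h : hist U W (k + t_ i)) (A : set (W (k + t_ i).+1)), measurable A ->
    rho (k + t_ i) h A = rhot i k (theta i (hpre (t_ i) k h), hseg (t_ i) k h) A.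

Definition exogenous_block_independent : Prop :=
  forall i k, (i < N)%N -> (k < n i)%N ->
  exists kappa : R.-pker (noises W (t_ i) k) ~> (W (k + t_ i).+1),
  forall (h : hist U W (k + t_ i)) (A : set (W (k + t_ i).+1)), measurable A ->
    rho (k + t_ i) h A = kappa (hnoise (t_ i) k h) A.

Section cost.
Variable ell : forall i, X i * seg U W (t_ i) (n i) -> \bar R.
Arguments ell : clear implicits.

(* The sum over i' < i of the costs of the blocks i'. *)
Fixpoint block_costs (i : nat) : hist U W (t_ i) -> \bar R :=
  match i return hist U W (t_ i) -> \bar R with
  | 0 => fun=> 0
  | i'.+1 => fun h =>
      block_costs (hpre (t_ i') (n i') h) +
      ell i' (theta i' (hpre (t_ i') (n i') h), hseg (t_ i') (n i') h)
  end.

End cost.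

Section nested.
Variables (i : nat) (x : X i).

Definition inf_int (k : nat) (phi : seg U W (t_ i) k.+1 -> \bar R)
    (g : seg U W (t_ i) k) : \bar R :=
  ereal_inf [set cintegral (rhot i k (x, g)) (fun w => phi (g, (u, w))) |
             u in [set: U (k + t_ i)]].

(* [inf_int 0] is the outermost of the k operators. *)
Fixpoint nested_inf_int (k : nat) : (seg U W (t_ i) k -> \bar R) -> \bar R :=
  match k return (seg U W (t_ i) k -> \bar R) -> \bar R with
  | 0 => fun phi => phi tt
  | k'.+1 => fun phi => nested_inf_int (inf_int phi)
  end.

End nested.

End reduction.

Arguments block_costs {dU dW dX U W X R n} theta ell {i} h.
Arguments nested_inf_int {dU dW dX U W X R n} rhot {i} x {k} phi.

(* Main.v *)
(* The value function satisfies the backward (Bellman) recursion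
     V_t(h) = inf_u \int V_{t+1}(h, u, w) rho_t(dw | h),
   and grouping the steps of one block turns it into the nested formula, since
   the past costs are additive constants and the kernels of a block depend on
   the past only through theta.  The recursion needs the lower semianalytic
   functions to be stable under these operations, and an eps-optimal
   universally measurable control.  Analytic sets are handled as projections
   of measurable subsets of X * (nat -> nat): every Borel space is a measurable
   image of the Baire space nat -> nat, so topology is needed only for that
   fact and for the measurability of the diagonal.  Such a projection is the
   result of a Suslin operation (x is in it iff some branch s has x in
   Q(s_0, ..., s_(n-1)) for all n); approximating the branches from inside by the
   compact sets {s | s <= t} gives Lusin's theorem and, uniformly in a kernel,
   the analyticity of {x | k_x(A_x) > c}; the leftmost branch gives the
   selection. *)
From HB Require Import structures.
Require Import Defs.
From mathcomp Require Import all_boot all_order all_algebra.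
From mathcomp Require Import all_classical all_reals all_analysis.
From mathcomp Require Import measurable_realfun lra.

Set Implicit Arguments.
Unset Strict Implicit.
Unset Printing Implicit Defensive.
Import Order.TTheory GRing.Theory Num.Theory.

Local Open Scope classical_set_scope.
Local Open Scope ring_scope.
Local Open Scope ereal_scope.

(** * Measurability by comprehension *)

(** Strict sublevel sets are the right side to work on: an infimum over controls becomes a
    projection, whereas Suslin sets are not closed under complement. For integrals this seems to
    fail, since the staircase sums that approximate them measure the sets {phi >= a}. But for mass 1
    an upper bound on the measure of {phi >= a} is a lower bound on that of {phi < a}, and this is
    why the kernel theorem speaks of an outer measure exceeding c. Universal measurability is
    checked one probability at a time, in its completed sigma-field, where the ordinary
    measurability lemmas apply. The recursion is not run on functions V_t: [value] always starts
    from [w0], and [value_step] trades a final cost at time t+1 for its Bellman transform at time t.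
    Only laws started from [w0] occur, no conditional law has to be built, and each step has to
    produce a control at a single time. Iterated integrals are compared by monotonicity, which for
    nonnegative functions holds without measurability. *)

Lemma measurable_preim d d' (T : measurableType d) (T' : measurableType d')
    (f : T -> T') (A : set T') :
  measurable_fun setT f -> measurable A -> measurable [set x | A (f x)].
Proof. by move=> mf mA; have := mf measurableT _ mA; rewrite setTI. Qed.

Lemma measurable_by d (T : measurableType d) (A B : set T) :
  measurable B -> (forall x, A x <-> B x) -> measurable A.
Proof. by move=> mB AB; rewrite (_ : A = B)//; apply/seteqP; split => x /AB. Qed.

Lemma measurable_ex d (T : measurableType d) (I : countType) (P : I -> set T) :
  (forall i, measurable (P i)) -> measurable [set x | exists i, P i x].
Proof.
move=> mP.
rewrite (_ : [set x | _] =
    \bigcup_k (if unpickle k is Some i then P i else set0)).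
  by apply: bigcupT_measurable => k; case: unpickle.
apply/seteqP; split => x /=.
  by move=> [i Pi]; exists (pickle i) => //; rewrite pickleK.
by move=> [k _]; case: unpickle => // i; exists i.
Qed.

Lemma measurable_all d (T : measurableType d) (I : countType) (P : I -> set T) :
  (forall i, measurable (P i)) -> measurable [set x | forall i, P i x].
Proof.
move=> mP; rewrite -(setCK [set x | _]); apply: measurableC.
rewrite (_ : ~` _ = [set x | exists i, (~` P i) x]).
  by apply: measurable_ex => i; exact: measurableC.
by apply/seteqP; split => x /=; [move/existsNP|move=> [i nP] /(_ i)].
Qed.

Lemma measurable_and d (T : measurableType d) (A B : set T) :
  measurable A -> measurable B -> measurable [set x | A x /\ B x].
Proof. by move=> mA mB; exact: measurableI. Qed.

Lemma measurable_const d (T : measurableType d) (P : Prop) :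
  measurable [set _ : T | P].
Proof.
have [p|p] := pselect P.
  by rewrite (_ : [set _ | _] = setT)//; apply/seteqP; split.
by rewrite (_ : [set _ | _] = set0)//; apply/seteqP; split.
Qed.

Lemma measurable_imply d (T : measurableType d) (A B : set T) :
  measurable A -> measurable B -> measurable [set x | A x -> B x].
Proof.
move=> mA mB; rewrite (_ : [set x | _] = ~` A `|` B).
  by apply: measurableU => //; exact: measurableC.
by apply/seteqP; split => x /=; [have [|] := pselect (A x)|]; tauto.
Qed.

Lemma measurable_iff d (T : measurableType d) (A B : set T) :
  measurable A -> measurable B -> measurable [set x | A x <-> B x].
Proof. by move=> mA mB; apply: measurable_and; exact: measurable_imply. Qed.

(** * The Baire space *)

(** They generate the Borel sigma-field of the product topology; the Baire space enters as a
    measurable space only. *)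
Definition cylinders : set (set (nat -> nat)) :=
  [set A | exists n k, A = [set s | s n = k]].

Notation baire := (g_sigma_algebraType cylinders).

Lemma measurable_coord (B : nat -> Prop) (n : nat) :
  measurable [set s : baire | B (s n)].
Proof.
rewrite (_ : [set s | _] = [set s : baire | exists k, B k /\ s n = k]).
  apply: measurable_ex => k; apply: measurable_and; first exact: measurable_const.
  by apply: sub_sigma_algebra; exists n, k.
by apply/seteqP; split => s /=; [exists (s n)|move=> [k [Bk ->]]].
Qed.

Lemma measurable_fun_baire d (T : measurableType d) (f : T -> baire) :
  (forall n k, measurable [set x | f x n = k]) -> measurable_fun setT f.
Proof.
move=> mf; apply: (@measurability _ _ _ _ setT f (cylinders : set (set baire))) => //.
by move=> _ [_ [n [k ->]] <-]; rewrite setTI; exact: mf.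
Qed.

(** Reads one sequence as countably many, through the pairing [pickle]. Any countable family of
    witnesses thus fits into one branch, and a single existential over [baire] absorbs it. *)
Definition slice (k : nat) (s : baire) : baire := fun m => s (pickle (k, m)).

Lemma measurable_slice k : measurable_fun setT (slice k).
Proof. by apply: measurable_fun_baire => n j; exact: (measurable_coord (fun i => i = j)). Qed.

Lemma slice_surj (F : nat -> baire) : exists s, forall k, slice k s = F k.
Proof.
exists (fun m => if unpickle m is Some (k, j) then F k j else 0%N) => k.
by apply/funext => m; rewrite /slice pickleK.
Qed.

Definition agree (n : nat) (s s' : nat -> nat) := forall i, (i < n)%N -> s i = s' i.

Lemma agree_sym n s s' : agree n s s' -> agree n s' s.
Proof. by move=> h i /h. Qed.

Lemma agree_le n m s s' : (n <= m)%N -> agree m s s' -> agree n s s'.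
Proof. by move=> nm h i /leq_trans /(_ nm) /h. Qed.

Lemma measurable_agree n s : measurable [set s' : baire | agree n s' s].
Proof.
apply: measurable_all => i; apply: measurable_imply; first exact: measurable_const.
exact: (measurable_coord (fun k => k = s i)).
Qed.

(** * Suslin sets *)

Section suslin.
Context d (X : measurableType d).

Definition suslin (A : set X) : Prop :=
  exists2 G : set (X * baire), measurable G &
    A = [set x | exists s, G (x, s)].

End suslin.

Lemma suslin_measurable d (X : measurableType d) (A : set X) :
  measurable A -> suslin A.
Proof.
move=> mA; exists (fst @^-1` A).
  exact: (measurable_preim (@measurable_fst _ _ X baire)).
by apply/seteqP; split => x /=; [exists (fun=> 0%N)|case].
Qed.

Lemma measurable_fun_map2 d1 d2 d3 d4 (T : measurableType d1) (X : measurableType d2)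
    (Y : measurableType d3) (Z : measurableType d4) (f : T -> Y) (g : X -> Z) :
  measurable_fun setT f -> measurable_fun setT g ->
  measurable_fun setT (fun t : T * X => (f t.1, g t.2)).
Proof.
move=> mf mg; apply: measurable_fun_pair.
  exact: (measurableT_comp mf).
exact: (measurableT_comp mg).
Qed.

Lemma suslin_preimage d d' (X : measurableType d) (Y : measurableType d')
    (f : X -> Y) (A : set Y) :
  measurable_fun setT f -> suslin A -> suslin (f @^-1` A).
Proof.
move=> mf [G mG ->]; exists [set p | G (f p.1, p.2)] => //.
exact: (measurable_preim (measurable_fun_map2 mf (@measurable_id _ _ _))).
Qed.

Lemma suslin_ex d (X : measurableType d) (A : nat -> set X) :
  (forall k, suslin (A k)) -> suslin [set x | exists k, A k x].
Proof.
move=> /(_ _)/cid2-/all_sig2 [G mG AE].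
(* Entry 0 of [slice 0] stores the index of the union, [slice 1] the witness. *)
exists [set p | exists k, slice 0 p.2 0%N = k /\ G k (p.1, slice 1 p.2)].
  apply: measurable_ex => k; apply: measurable_and.
    exact: (measurable_preim (measurableT_comp (measurable_slice 0)
      (@measurable_snd _ _ X baire)) (measurable_coord (fun m => m = k) 0%N)).
  exact: (measurable_preim (measurable_fun_map2 (@measurable_id _ _ _)
    (@measurable_slice 1))).
apply/seteqP; split => x /=.
  move=> [k]; rewrite AE => -[s Gs].
  have [s' s'E] := slice_surj (fun j => if j is 0%N then fun=> k else s).
  by exists s', k; rewrite !s'E.
by move=> [s [k [_ Gk]]]; exists k; rewrite AE; exists (slice 1 s).
Qed.

Lemma suslin_all d (X : measurableType d) (A : nat -> set X) :
  (forall k, suslin (A k)) -> suslin [set x | forall k, A k x].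
Proof.
move=> /(_ _)/cid2-/all_sig2 [G mG AE].
exists [set p | forall k, G k (p.1, slice k p.2)].
  apply: measurable_all => k.
  exact: (measurable_preim (measurable_fun_map2 (@measurable_id _ _ _)
    (@measurable_slice k))).
apply/seteqP; split => x /=.
  move=> Ax; have /choice[t Gt] k : exists s, G k (x, s).
    by have := Ax k; rewrite AE.
  by have [s sE] := slice_surj t; exists s => k; rewrite sE.
by move=> [s Gs] k; rewrite AE; exists (slice k s).
Qed.

Lemma suslin_and d (X : measurableType d) (A B : set X) :
  suslin A -> suslin B -> suslin [set x | A x /\ B x].
Proof.
move=> sA sB.
rewrite (_ : [set x | _] = [set x | forall k : nat, (if k is 0%N then A else B) x]).
  by apply: suslin_all => -[|k].
apply/seteqP; split => x /=; first by move=> [? ?] [].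
by move=> h; split; [exact: (h 0%N)|exact: (h 1%N)].
Qed.

Lemma suslin_countex d (X : measurableType d) (I : countType) (A : I -> set X) :
  (forall k, suslin (A k)) -> suslin [set x | exists k, A k x].
Proof.
move=> sA.
rewrite (_ : [set x | _] = [set x | exists k,
    (if unpickle k is Some i then A i else set0) x]).
  by apply: suslin_ex => k; case: unpickle => [i|]; [exact: sA|exact: (suslin_measurable measurable0)].
apply/seteqP; split => x /=.
  by move=> [i Ai]; exists (pickle i); rewrite pickleK.
by move=> [k]; case: unpickle => // i; exists i.
Qed.

(** The property of Borel spaces behind projections and selections: points are coded by
    sequences. *)
Definition baire_image d (T : measurableType d) : Prop :=
  exists2 p : baire -> T, measurable_fun setT p & forall t, exists s, p s = t.

Lemma suslin_proj d d' (X : measurableType d) (Y : measurableType d')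
    (A : set (X * Y)) :
  baire_image Y -> suslin A -> suslin [set x | exists y, A (x, y)].
Proof.
move=> [p mp psurj] [G mG ->].
exists [set q | G ((q.1, p (slice 0 q.2)), slice 1 q.2)].
  apply: measurable_preim mG.
  have m2 := @measurable_snd _ _ X baire.
  apply: measurable_fun_pair; last exact: (measurableT_comp (measurable_slice 1)).
  apply: measurable_fun_pair; first exact: measurable_fst.
  apply: (measurableT_comp mp).
  exact: (measurableT_comp (measurable_slice 0)).
apply/seteqP; split => x /=.
  move=> [y [s Gs]]; have [t pt] := psurj y.
  have [s' s'E] := slice_surj (fun j => if j is 0%N then t else s).
  by exists s'; rewrite !s'E pt.
by move=> [s Gs]; exists (p (slice 0 s)), (slice 1 s).
Qed.

(** * Borel spaces *)

Lemma natSinv_gt0 (R : realType) (n : nat) : (0 < n.+1%:R^-1 :> R)%R.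
Proof. by rewrite invr_gt0. Qed.

Lemma natSinv_le (R : realType) (n m : nat) :
  (n <= m)%N -> (m.+1%:R^-1 <= n.+1%:R^-1 :> R)%R.
Proof. by move=> nm; rewrite lef_pV2 ?posrE// ler_nat. Qed.

Lemma natSinv_lt (R : realType) (e : R) :
  (0 < e)%R -> exists n, (n.+1%:R^-1 < e)%R.
Proof. by move=> e0; have [n] := ltr_add_invr e0; rewrite add0r => ne; exists n. Qed.

Section polish.
Variables (R : realType) (Y : completePseudoMetricType R).
Hypothesis polishY : polish Y.

Let r (n : nat) : R := n.+1%:R^-1.

Lemma polish_dense_seq : exists u : nat -> Y,
  forall y e, (0 < e)%R -> exists k, ball y e (u k).
Proof.
have [_ [D /countable_injP [c cinj] Dd]] := polishY.
(* [u k] is the point of [D] numbered [k] by the injection [c], and [point] if there is none. *)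
have /choice[u uP] : forall k : nat, exists y : Y,
    forall z, D z -> c z = k -> y = z.
  move=> k; have [[z [Dz zk]]|nz] := pselect (exists z, D z /\ c z = k).
    by exists z => z' Dz' z'k; apply: cinj; rewrite ?inE// zk z'k.
  by exists point => z Dz zk; exfalso; apply: nz; exists z.
exists u => y e e0.
have [|z [/interior_subset yz Dz]] := Dd _ _ (@open_interior _ (ball y e)).
  by exists y; exact: nbhsx_ballx.
by exists (c z); rewrite (uP _ z).
Qed.

Lemma polish_ball_eq (x y : Y) : (forall n, ball x (r n + r n)%R y) -> x = y.
Proof.
move=> xy; apply: (close_eq polishY.1); rewrite ball_close => e.
have [n ne] := @natSinv_lt R (e%:num / 2)%R ltac:(by []).
apply: le_ball (xy n); rewrite [leRHS]splitr; exact/ltW/ltrD.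
Qed.

Section limit.
Variable u : nat -> Y.
Hypothesis u_dense : forall y e, (0 < e)%R -> exists k, ball y e (u k).

(** A Cauchy condition with an explicit rate, hence a countable conjunction of conditions on the
    entries of [s]. *)
Let good (s : baire) := forall n m, (n <= m)%N ->
  ball (u (s n)) (r n + r n)%R (u (s m)).

(** Later points of a good sequence are within [r n + r n] of [u (s n)]; the third [r n] pays for
    the passage to the limit. *)
Let near_limit (s : baire) (y : Y) :=
  forall n, ball (u (s n)) (r n + r n + r n)%R y.

Let measurable_good : measurable (good : set baire).
Proof.
apply: measurable_all => n; apply: measurable_all => m.
apply: measurable_imply; first exact: measurable_const.
apply: (@measurable_by _ _ _ [set s : baire | exists i, s n = i /\
    exists j, s m = j /\ ball (u i) (r n + r n)%R (u j)]).
  apply: measurable_ex => i; apply: measurable_and.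
    exact: (measurable_coord (fun k => k = i)).
  apply: measurable_ex => j; apply: measurable_and.
    exact: (measurable_coord (fun k => k = j)).
  exact: measurable_const.
move=> s /=; split; first by move=> h; exists (s n); split=> //; exists (s m).
by move=> [_ [<- [_ [<-]]]].
Qed.

Let good_limit (s : baire) : good s -> exists y, near_limit s y.
Proof.
move=> gs.
have : cauchy (u (s n) @[n --> \oo]).
  apply/cauchyP => e e0.
  have [n ne] := @natSinv_lt R (e / 2)%R ltac:(by rewrite divr_gt0).
  exists (u (s n)); exists n => // m /= nm; apply: le_ball (gs _ _ nm).
  by rewrite [leRHS]splitr; exact/ltW/ltrD.
move/cauchy_cvg => /cvg_ex[y /cvg_ballP sy]; exists y => n.
have [m _ my] := sy _ (natSinv_gt0 R n).
apply: ball_triangle (gs n (maxn n m) (leq_maxl _ _)) _.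
by apply/ball_sym/my; rewrite /= leq_maxr.
Qed.

Let lim_baire (s : baire) : Y :=
  if pselect (good s) is left gs then projT1 (cid (good_limit gs)) else point.

Let lim_baireP s : good s -> near_limit s (lim_baire s).
Proof. by rewrite /lim_baire; case: pselect => // gs _; case: cid. Qed.

Let r_gt0 n : (0 < r n)%R. Proof. exact: natSinv_gt0. Qed.

Let measurable_lim_baire (B : set Y) : <<s open >> B ->
  measurable [set s : baire | B (lim_baire s)].
Proof.
move: B; apply: smallest_sub.
  split => [|B mB|F mF].
  - exact: measurable_const.
  - rewrite (_ : [set s | _] = ~` [set s : baire | B (lim_baire s)]).
      exact: measurableC.
    by apply/seteqP; split => s /=; [move=> []|].
  - rewrite (_ : [set s | _] = [set s : baire | exists i, F i (lim_baire s)]).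
      exact: measurable_ex.
    by apply/seteqP; split => s /=; [move=> [i _]|move=> [i]]; exists i.
move=> B oB /=.
(* For a good [s] the limit is in the open set [B] iff [B] contains one of the balls known to
   contain the limit. All other sequences are sent to [point]. *)
rewrite (_ : [set s | _] = [set s : baire | (good s /\ exists n, exists k,
    s n = k /\ ball (u k) (r n + r n + r n)%R `<=` B)]
    `|` [set s : baire | ~ good s /\ B point]).
  apply: measurableU; apply: measurable_and => //.
  - apply: measurable_ex => n; apply: measurable_ex => k.
    apply: measurable_and; last exact: measurable_const.
    exact: (measurable_coord (fun m => m = k)).
  - exact: measurableC.
  - exact: measurable_const.
apply/seteqP; split => s /=.
  have [gs|ngs] := pselect (good s); last first.
    by rewrite /lim_baire; case: pselect => // _; right.
  have := lim_baireP gs; set y := lim_baire s => sy By; left; split => //.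
  have /nbhs_ballP[e /= e0 eB] : nbhs y B by exact: open_nbhs_nbhs.
  (* The ball of radius 3 r_n about [u (s n)] contains [y], so it lies within 6 r_n of [y]. *)
  have [n ne] := @natSinv_lt R (e / 6)%R ltac:(by rewrite divr_gt0).
  exists n, (s n); split => // z /(ball_triangle (ball_sym (sy n))) yz.
  apply: eB; apply: le_ball yz.
  by move: ne; rewrite -/(r n) => ne; lra.
move=> [[gs [n [_ [<- sB]]]]|[ngs Bp]]; first by apply: sB; exact: lim_baireP.
by rewrite /lim_baire; case: pselect.
Qed.

Let lim_baire_surj y : exists s, lim_baire s = y.
Proof.
have /choice[s sy] n : exists k, ball y (r n) (u k) by exact: u_dense.
have gs : good s.
  move=> n m nm; apply: ball_triangle (ball_sym (sy n)) _.
  by apply: le_ball (sy m); exact: natSinv_le.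
exists s; apply/esym/polish_ball_eq => n.
(* [y] is within r_k of [u (s k)] and the coded limit within 3 r_k of it; 4 r_k is less than 2
   r_n. *)
have [k ke] := @natSinv_lt R (r n / 2)%R ltac:(by rewrite divr_gt0).
apply: le_ball (ball_triangle (sy k) (lim_baireP gs k)).
by move: ke; rewrite -/(r k) => ke; lra.
Qed.

Lemma polish_baire_image_aux : exists p : baire -> Y,
  (forall B, <<s open >> B -> measurable [set s | B (p s)]) /\
  forall y, exists s, p s = y.
Proof. by exists lim_baire. Qed.

End limit.

Lemma polish_baire_image : exists p : baire -> Y,
  (forall B, <<s open >> B -> measurable [set s | B (p s)]) /\
  forall y, exists s, p s = y.
Proof. have [u uP] := polish_dense_seq; exact: polish_baire_image_aux uP. Qed.

Lemma polish_separated : exists E : nat * nat -> set Y,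
  (forall i, open (E i)) /\ forall x y, (forall i, E i x <-> E i y) -> x = y.
Proof.
have [u uP] := polish_dense_seq.
(* Interiors, because a [ball] of a pseudometric type need not be open. *)
exists (fun kn => interior (ball (u kn.1) (r kn.2))); split.
  by move=> i; exact: open_interior.
move=> x y xy; apply: polish_ball_eq => n.
have rn0 : (0 < r n / 2)%R by rewrite divr_gt0//; exact: natSinv_gt0.
have [k xk] : exists k, ball x (r n / 2) (u k) by exact: uP.
have xE : interior (ball (u k) (r n)) x.
  apply/nbhs_ballP; exists (r n / 2)%R => //=.
  by move=> z xz; apply: ball_split xz; exact: ball_sym.
have /interior_subset yE := (xy (k, n)).1 xE.
exact: ball_triangle (ball_sym (interior_subset xE)) yE.
Qed.

End polish.

Lemma borel_baire_image (R : realType) d (T : measurableType d) :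
  borel_space R T -> baire_image T.
Proof.
move=> [Y [f [pY finj rf fm]]].
have [p [mp psurj]] := polish_baire_image pY.
have mE : measurable [set s | exists t, f t = p s].
  rewrite (_ : [set s | _] = [set s | range f (p s)]); first exact: mp.
  by apply/seteqP; split => s /= [t]; exists t.
(* The inverse of [f] after [p]. Codes of points outside [range f] go to [point]; they form a
   measurable set because [range f] is Borel. *)
pose q s := if pselect (exists t, f t = p s) is left e then projT1 (cid e) else point.
have qE t s : p s = f t -> q s = t.
  move=> ps; rewrite /q; case: pselect => [e|]; last by case; exists t.
  by case: cid => t' /=; rewrite ps => /finj.
exists q.
  move=> _ A /fm [B mB AE]; rewrite setTI.
  rewrite (_ : _ @^-1` _ = [set s | (exists t, f t = p s) /\ B (p s)]
     `|` [set s | (~ exists t, f t = p s) /\ A point]).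
    apply: measurableU; apply: measurable_and => //.
    - exact: mp.
    - exact: measurableC.
    - exact: measurable_const.
  apply/seteqP; split => s /=.
    have [[t ts]|nt] := pselect (exists t, f t = p s).
      by rewrite (qE t)// AE /= ts; left; split=> //; exists t.
    by rewrite /q; case: pselect => // _; right.
  move=> [[[t ts] Bs]|[nt Ap]]; first by rewrite (qE t)// AE /= ts.
  by rewrite /q; case: pselect.
by move=> t; have [s ps] := psurj (f t); exists s; exact: qE.
Qed.

(** This makes the diagonal measurable: equality of two points is agreement on countably many
    measurable tests. *)
Definition countably_separated d (T : measurableType d) : Prop :=
  exists (I : countType) (E : I -> set T), (forall i, measurable (E i)) /\
    forall x y, (forall i, E i x <-> E i y) -> x = y.

Lemma borel_countably_separated (R : realType) d (T : measurableType d) :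
  borel_space R T -> countably_separated T.
Proof.
move=> [Y [f [pY finj rf fm]]]; have [E [oE sepE]] := polish_separated pY.
exists (nat * nat)%type, (fun i => f @^-1` E i); split.
  by move=> i; apply/fm; exists (E i) => //; exact: sub_sigma_algebra.
by move=> x y xy; exact/finj/sepE.
Qed.

Lemma countably_separated_prod d d' (T : measurableType d)
    (T' : measurableType d') :
  countably_separated T -> countably_separated T' ->
  countably_separated (T * T')%type.
Proof.
move=> [I [E [mE sE]]] [J [F [mF sF]]].
exists (I + J)%type, (fun k => match k with
  | inl i => [set p | E i p.1] | inr j => [set p | F j p.2] end); split.
  case=> [i|j]; first exact: (measurable_preim (@measurable_fst _ _ T T')).
  exact: (measurable_preim (@measurable_snd _ _ T T')).
move=> [x x'] [y y'] xy; congr pair.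
  by apply: sE => i; exact: (xy (inl i)).
by apply: sF => j; exact: (xy (inr j)).
Qed.

Lemma countably_separated_unit : countably_separated unit.
Proof. by exists unit, (fun=> set0); split => // x y _; case: x; case: y. Qed.

Lemma measurable_eq_fun d d' (T : measurableType d) (X : measurableType d')
    (f g : T -> X) :
  countably_separated X -> measurable_fun setT f -> measurable_fun setT g ->
  measurable [set t | f t = g t].
Proof.
move=> [I [E [mE sE]]] mf mg.
rewrite (_ : [set t | _] = [set t | forall i, E i (f t) <-> E i (g t)]).
  by apply: measurable_all => i; apply: measurable_iff; exact: measurable_preim.
by apply/seteqP; split => t /=; [move=> ->|move/sE].
Qed.

(** The image is the projection of the graph of [f \o p] over the codes of [B], and this graph is
    measurable because the diagonal of [X] is. *)
Lemma analytic_suslin (R : realType) d (X : measurableType d) (A : set X) :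
  countably_separated X -> analytic R A -> suslin A.
Proof.
move=> sX [d' [Y [B [f [/borel_baire_image[p mp psurj] mB mf ->]]]]].
exists [set q | B (p q.2) /\ f (p q.2) = q.1].
  have mp2 : measurable_fun setT (fun q : X * baire => p q.2).
    exact: measurableT_comp mp (@measurable_snd _ _ X baire).
  apply: measurable_and; first exact: (measurable_preim mp2).
  apply: measurable_eq_fun => //; exact: (measurableT_comp mf).
apply/seteqP; split => x /=.
  by move=> [y By <-]; have [s ps] := psurj y; exists s; rewrite ps.
by move=> [s [Bs <-]]; exists (p s).
Qed.

(** * The Suslin operation *)

Definition scheme d (X : measurableType d) (Q : seq nat -> set X) : Prop :=
  (forall l, measurable (Q l)) /\ (forall l k, Q (rcons l k) `<=` Q l).

Definition branch (X : Type) (Q : seq nat -> set X) (s : baire) : set X :=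
  [set x | forall n, Q (mkseq s n) x].

Lemma mkseq_agree (s s' : baire) n : mkseq s n = mkseq s' n <-> agree n s s'.
Proof.
split=> [e i ilt|h].
  by have := congr1 (nth 0%N ^~ i) e; rewrite !nth_mkseq.
by apply/eq_in_map => i; rewrite mem_iota => /h.
Qed.

Lemma measurable_mkseq n l : measurable [set s : baire | mkseq s n = l].
Proof.
have [nl|nl] := eqVneq n (size l); last first.
  apply: (measurable_by measurable0) => s; split => // sl.
  by case/eqP: nl; rewrite -sl size_mkseq.
apply: (measurable_by (measurable_agree n (nth 0%N l))) => s /=.
have e : mkseq (nth 0%N l) n = l by rewrite nl mkseq_nth.
by split => [sl|/mkseq_agree ->//]; apply/mkseq_agree; rewrite e.
Qed.

(** * Measurable subsets of [X * baire] as results of a Suslin operation *)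

Section normal_form.
Context d (X : measurableType d).

(** Continuity into a discrete space: the value is decided by a finite prefix of [s]. *)
Let loc_const (T : Type) (h : baire -> T) : Prop :=
  forall s, exists m, forall s', agree m s s' -> h s' = h s.

Let loc_const_cst T (a : T) : loc_const (fun=> a).
Proof. by move=> s; exists 0%N. Qed.

Let loc_const_coord n : loc_const (fun s => s n).
Proof. by move=> s; exists n.+1 => s' ->. Qed.

Let loc_const2 T T' T'' (F : T -> T' -> T'') h h' :
  loc_const h -> loc_const h' -> loc_const (fun s => F (h s) (h' s)).
Proof.
move=> hc hc' s; have [m mP] := hc s; have [m' mP'] := hc' s.
exists (maxn m m') => s' ss'.
rewrite mP ?mP'//; apply: agree_le ss'; [exact: leq_maxr|exact: leq_maxl].
Qed.

Let slice_agree k m :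
  exists M, forall s s', agree M s s' -> agree m (slice k s) (slice k s').
Proof.
elim: m => [|m [M IH]]; first by exists 0%N.
exists (maxn M (pickle (k, m)).+1) => s s' ss' i; rewrite ltnS leq_eqVlt.
move=> /predU1P[->|im]; first by apply: ss'; rewrite leq_maxr.
by apply: IH im; apply: agree_le ss'; exact: leq_maxl.
Qed.

Let loc_const_slice T (h : baire -> T) k :
  loc_const h -> loc_const (fun s => h (slice k s)).
Proof.
move=> hc s; have [m mP] := hc (slice k s); have [M MP] := slice_agree k m.
by exists M => s' /MP /mP.
Qed.

(** Membership becomes a countable conjunction of measurable conditions on [x], each decided by a
    finite prefix of a sequence [s] that carries [t] in [slice 0] and auxiliary witnesses in the
    other slices. *)
Let nform (G : set (X * baire)) : Prop :=
  exists (I : countType) (Q : I -> baire -> set X),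
  [/\ forall i s, measurable (Q i s), forall i, loc_const (Q i) &
      forall x t, G (x, t) <-> exists s, slice 0 s = t /\ forall i, Q i s x].

Let nform_eq (G G' : set (X * baire)) :
  nform G -> (forall x t, G' (x, t) <-> G (x, t)) -> nform G'.
Proof.
move=> [I [Q [mQ lQ GQ]]] GG'; exists I, Q; split => // x t.
by rewrite GG'.
Qed.

Let nform_fst (A : set X) : measurable A -> nform [set p | A p.1].
Proof.
move=> mA; exists unit, (fun _ _ => A); split => //=.
move=> x t; split; last by move=> [s [_ /(_ tt)]].
by move=> Ax; have [s sE] := slice_surj (fun=> t); exists s.
Qed.

Let nform_snd (B : nat -> Prop) n : nform [set p | B (p.2 n)].
Proof.
exists unit, (fun _ s => [set _ | B (slice 0 s n)]); split => //=.
- by move=> _ s; exact: measurable_const.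
- move=> _; apply: (@loc_const_slice _ (fun s => [set _ | B (s n)])).
  exact: (@loc_const2 _ _ _ (fun k _ => [set _ | B k]) _ _ (loc_const_coord n)
    (loc_const_cst tt)).
move=> x t; split; last by move=> [s [<- /(_ tt)]].
by move=> Bt; have [s sE] := slice_surj (fun=> t); exists s; rewrite sE.
Qed.

(** Forces the copy of [t] inside [slice k s] to be [t], entry by entry, since equality of whole
    sequences is not decided by a finite prefix. *)
Let linked k j : baire -> set X :=
  fun s => [set _ | slice 0 (slice k s) j = slice 0 s j].

Let loc_const_linked k j : loc_const (linked k j).
Proof.
apply: (@loc_const2 _ _ _ (fun a b => [set _ | a = b])
  (fun s => slice 0 (slice k s) j) (fun s => slice 0 s j)).
  apply: (@loc_const_slice _ (fun s => slice 0 s j)).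
  exact: (@loc_const_slice _ (fun s => s j)).
exact: (@loc_const_slice _ (fun s => s j)).
Qed.

Let nform_all (G : nat -> set (X * baire)) :
  (forall k, nform (G k)) -> nform [set p | forall k, G k p].
Proof.
move=> /(_ _)/cid-/all_sig[I] /(_ _)/cid-/all_sig[Q GQ].
(* [slice k.+1] holds the whole sequence witnessing [G k], linked to the common [t] in [slice 0]. *)
exists ({k : nat & I k} + nat * nat)%type, (fun i s => match i with
  | inl (existT k j) => Q k j (slice k.+1 s)
  | inr (k, j) => linked k.+1 j s
  end); split.
- move=> [[k j]|[k j]] s; first by have [mQ _ _] := GQ k.
  exact: measurable_const.
- move=> [[k j]|[k j]]; last exact: loc_const_linked.
  by have [_ lQ _] := GQ k; exact: (@loc_const_slice _ (Q k j)).
move=> x t /=; split.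
  move=> Gx; have /choice[u uP] k : exists s, slice 0 s = t /\ forall i, Q k i s x.
    by have [_ _ <-] := GQ k.
  have [s sE] := slice_surj (fun j => if j is k.+1 then u k else t).
  exists s; split; first by rewrite sE.
  move=> [[k j]|[k j]]; first by rewrite sE; exact: (uP k).2.
  by rewrite /linked/= !sE (uP k).1.
move=> [s [<- Qs]] k; have [_ _ ->] := GQ k.
exists (slice k.+1 s); split => [|i]; last exact: (Qs (inl (existT _ k i))).
by apply/funext => j; exact: (Qs (inr (k, j))).
Qed.

Let nform_ex (G : nat -> set (X * baire)) :
  (forall k, nform (G k)) -> nform [set p | exists k, G k p].
Proof.
move=> /(_ _)/cid-/all_sig[I] /(_ _)/cid-/all_sig[Q GQ].
(* Entry 0 of [slice 2] names [k], which voids the conditions of the other sets; [slice 1] holds the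
   witness. *)
exists ({k : nat & I k} + nat)%type, (fun i s => match i with
  | inl (existT k j) => [set x | slice 2 s 0%N = k -> Q k j (slice 1 s) x]
  | inr j => linked 1 j s
  end); split.
- move=> [[k j]|j] s; last exact: measurable_const.
  apply: measurable_imply; first exact: measurable_const.
  by have [mQ _ _] := GQ k.
- move=> [[k j]|j]; last exact: loc_const_linked.
  have [_ lQ _] := GQ k.
  apply: (@loc_const2 _ _ _ (fun a (A : set X) => [set x | a = k -> A x])
    (fun s => slice 2 s 0%N)).
    exact: (@loc_const_slice _ (fun s => s 0%N)).
  exact: (@loc_const_slice _ (Q k j)).
move=> x t /=; split.
  move=> [k]; have [_ _ ->] := GQ k => -[u [ut Qu]].
  have [s sE] := slice_surj (fun j => match j with
    | 0%N => t | 1%N => u | _ => fun=> k end).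
  exists s; split; first by rewrite sE.
  move=> [[k' j]|j]; last by rewrite /linked/= !sE ut.
  by rewrite !sE => kk'; move: j; rewrite -kk'.
move=> [s [<- Qs]]; exists (slice 2 s 0%N); have [_ _ ->] := GQ (slice 2 s 0%N).
exists (slice 1 s); split => [|i]; last exact: (Qs (inl (existT I _ i)) erefl).
by apply/funext => j; exact: (Qs (inr j)).
Qed.

(** [nform] is closed under countable unions and intersections; asking it of the complement as well
    yields a sigma-algebra, so that checking generators suffices. *)
Let nform2 (G : set (X * baire)) := nform G /\ nform (~` G).

Let sigma_algebra_nform2 : sigma_algebra setT nform2.
Proof.
split => [|G|G nG].
- split; first by apply: (nform_eq (nform_fst measurable0)).
  by apply: (nform_eq (nform_fst measurableT)) => x t; split=> // _ [].
- rewrite setTD => -[nG nG']; split => //.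
  by rewrite setCK.
split.
  apply: (nform_eq (nform_ex (fun k => (nG k).1))) => x t; split.
    by move=> [k _]; exists k.
  by move=> [k]; exists k.
apply: (nform_eq (nform_all (fun k => (nG k).2))) => x t; split.
  by move=> h k Gk; apply: h; exists k.
by move=> h [k _]; exact: h.
Qed.

Let nform_measurable (G : set (X * baire)) : measurable G -> nform2 G.
Proof.
move: G; apply: smallest_sub => // _ [|] [B mB <-]; rewrite setTI.
  split; first exact: nform_fst.
  exact: (nform_fst (measurableC mB)).
move: B mB; apply: smallest_sub.
  have [n0 nD nU] := sigma_algebra_nform2.
  split => [|B|B]; first by rewrite /= preimage_set0.
    by move=> /nD; rewrite !setTD.
  by move=> /nU; rewrite preimage_bigcup.
move=> _ [n [k ->]]; split; first exact: (nform_snd (fun j => j = k)).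
exact: (nform_snd (fun j => j <> k)).
Qed.

Theorem suslin_normal_form (G : set (X * baire)) : measurable G ->
  exists2 Q, scheme Q & forall x t,
    G (x, t) <-> exists2 s, slice 0 s = t & branch Q s x.
Proof.
move=> /nform_measurable[[I [Q [mQ lQ GQ]]] _].
pose ext (l : seq nat) (s : baire) := mkseq s (size l) = l.
(* Condition [i] is imposed at [l] once its number is below the length of [l] and all extensions of
   [l] give it the same value. Longer prefixes decide more conditions, so the sets decrease. *)
pose Q' (l : seq nat) := [set x | forall i s, (pickle i < size l)%N -> ext l s ->
  (forall s', ext l s' -> Q i s' = Q i s) -> Q i s x].
exists Q'; first split.
- move=> l.
  apply: (@measurable_by _ _ _ [set x | forall i, (pickle i < size l)%N ->
     (forall s, ext l s -> Q i s = Q i (nth 0%N l)) -> Q i (nth 0%N l) x]).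
    apply: measurable_all => i.
    apply: measurable_imply; first exact: measurable_const.
    by apply: measurable_imply; first exact: measurable_const.
  move=> x; split => h i; first by move=> il; apply: h; rewrite // /ext mkseq_nth.
  move=> s il sl sP; rewrite -(sP (nth 0%N l)) ?/ext ?mkseq_nth//.
  by apply: h => // s' s'l; rewrite !sP// /ext mkseq_nth.
- move=> l k x h i s il sl sP.
  have extW s' : ext (rcons l k) s' -> ext l s'.
    rewrite /ext size_rcons mkseqS => /rcons_inj[]; by [].
  (* An extension of [rcons l k]; it may replace [s], because condition [i] is already decided by
     [l]. *)
  pose s1 : baire := fun j => if j == size l then k else s j.
  have s1l : ext (rcons l k) s1.
    rewrite /ext size_rcons mkseqS; congr rcons; last by rewrite /s1 eqxx.
    rewrite -[RHS]sl; apply/mkseq_agree => j jl.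
    by rewrite /s1 (ltn_eqF jl).
  rewrite -(sP s1); last exact: extW.
  apply: h => //; first by rewrite size_rcons ltnS ltnW.
  by move=> s' /extW s'l; rewrite !sP//; exact: extW.
move=> x t; rewrite GQ; split => -[s].
  move=> [st Qs]; exists s => // n i s' _ + h; rewrite -(h s)//.
  by rewrite /ext size_mkseq.
move=> st Qs; exists s; split => // i.
have [m mP] := lQ i s.
(* A prefix long enough to decide condition [i] and to exceed its number. *)
have := Qs (maxn m (pickle i).+1) i s; rewrite /ext size_mkseq; apply => //.
  exact: leq_maxr.
by move=> s' /mkseq_agree ss'; apply: mP; apply: agree_sym; apply: agree_le ss'; exact: leq_maxl.
Qed.

Lemma suslin_scheme (A : set X) : suslin A ->
  exists2 Q, scheme Q & A = [set x | exists s, branch Q s x].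
Proof.
move=> [G /suslin_normal_form[Q sQ GQ] ->]; exists Q => //.
apply/seteqP; split => x /=.
  by move=> [t]; rewrite GQ => -[s _ Qs]; exists s.
by move=> [s Qs]; exists (slice 0 s); rewrite GQ; exists s.
Qed.

Lemma measurable_branch Q : scheme Q -> measurable [set p : X * baire | branch Q p.2 p.1].
Proof.
move=> [mQ _]; apply: measurable_all => n.
apply: (@measurable_by _ _ _ [set p : X * baire | exists l, mkseq p.2 n = l /\ Q l p.1]).
  apply: measurable_ex => l; apply: measurable_and.
    exact: (measurable_preim (@measurable_snd _ _ X baire) (measurable_mkseq n l)).
  exact: (measurable_preim (@measurable_fst _ _ X baire)).
by move=> [x s] /=; split => [|[_ [<-]]]//; exists (mkseq s n).
Qed.

End normal_form.

Lemma scheme_take d (X : measurableType d) (Q : seq nat -> set X) l n :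
  scheme Q -> Q l `<=` Q (take n l).
Proof.
move=> [_ dQ]; elim/last_ind: l => [//|l k IH].
have [nl|nl] := leqP n (size l); last by rewrite take_oversize// size_rcons.
by rewrite -cats1 takel_cat// cats1; apply: subset_trans (dQ l k) IH.
Qed.

(** * Leftmost branches *)

Section leftmost.
Variables (X : Type) (B : seq nat -> set X).

(* [0] when no [rcons l k] works. *)
Definition leftmost_child (x : X) (l : seq nat) : nat :=
  if pselect (exists k, `[<B (rcons l k) x>]) is left e then ex_minn e else 0%N.

Fixpoint leftmost_prefix (x : X) (n : nat) : seq nat :=
  if n is m.+1 then
    rcons (leftmost_prefix x m) (leftmost_child x (leftmost_prefix x m))
  else [::].

Definition leftmost (x : X) : baire :=
  fun n => leftmost_child x (leftmost_prefix x n).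

(** Written as countably many Boolean operations on the sets [B l], so that measurability holds in
    any sigma-field containing them. *)
Lemma leftmost_childE x l k : leftmost_child x l = k <->
  (B (rcons l k) x /\ forall j, (j < k)%N -> ~ B (rcons l j) x) \/
  (k = 0%N /\ forall j, ~ B (rcons l j) x).
Proof.
rewrite /leftmost_child; case: pselect => [e|ne]; last first.
  have {}ne j : ~ B (rcons l j) x by move=> Bj; apply: ne; exists j; exact/asboolP.
  split; first by move=> <-; right.
  by move=> [[/ne]|[->]].
case: ex_minnP => m /asboolP Bm mmin; split.
  move=> <-; left; split => // j jm /asboolP /mmin.
  by rewrite leqNgt jm.
move=> [[Bk kmin]|[_ /(_ m)]]//.
apply/eqP; rewrite eqn_leq mmin/=; last exact/asboolP.
by rewrite leqNgt; apply/negP => /kmin.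
Qed.

Lemma mkseq_leftmost x n : mkseq (leftmost x) n = leftmost_prefix x n.
Proof. by elim: n => [|n IH] //=; rewrite mkseqS IH. Qed.

Lemma leftmostP x : B [::] x ->
  (forall l, B l x -> exists k, B (rcons l k) x) -> branch B (leftmost x) x.
Proof.
move=> B0 BS n; rewrite mkseq_leftmost; elim: n => [//|n /BS [k Bk]] /=.
have /(leftmost_childE x (leftmost_prefix x n) _).1 :=
  erefl (leftmost_child x (leftmost_prefix x n)).
by move=> [[]|[_ /(_ k)]].
Qed.

End leftmost.

Lemma measurable_leftmost d (X : measurableType d) (B : seq nat -> set X) n k :
  (forall l, measurable (B l)) -> measurable [set x | leftmost B x n = k].
Proof.
move=> mB.
have mchild l j : measurable [set x | leftmost_child B x l = j].
  apply: (measurable_by _ (fun x => leftmost_childE B x l j)).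
  apply: measurableU.
    apply: measurable_and => //; apply: measurable_all => i.
    by apply: measurable_imply; [exact: measurable_const|exact: measurableC].
  apply: measurable_and; first exact: measurable_const.
  by apply: measurable_all => i; exact: measurableC.
have mprefix m l : measurable [set x | leftmost_prefix B x m = l].
  elim: m l => [|m IH] l; first exact: (@measurable_const _ X ([::] = l)).
  apply: (@measurable_by _ _ _ [set x | exists l', leftmost_prefix B x m = l' /\
     exists j, leftmost_child B x l' = j /\ rcons l' j = l]).
    apply: measurable_ex => l'; apply: measurable_and; first exact: IH.
    apply: measurable_ex => j; apply: measurable_and; first exact: mchild.
    exact: measurable_const.
  move=> x /=; split => [<-|[_ [<- [_ [<-]]]]]//.
  by exists (leftmost_prefix B x m); split => //; exists (leftmost_child B x (leftmost_prefix B x m)).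
apply: (@measurable_by _ _ _ [set x | exists l, leftmost_prefix B x n = l /\
   leftmost_child B x l = k]).
  apply: measurable_ex => l; apply: measurable_and; first exact: mprefix.
  exact: mchild.
move=> x; rewrite /leftmost/=; split => [<-|[_ [<-]]]//.
by exists (leftmost_prefix B x n).
Qed.

(** Dependent choice along finite sequences, read off from the leftmost branch over a one-point
    space. *)
Lemma dependent_branch (good : seq nat -> Prop) : good [::] ->
  (forall l, good l -> exists k, good (rcons l k)) ->
  exists s : baire, forall n, good (mkseq s n).
Proof.
move=> g0 gS; exists (leftmost (fun l => [set _ : unit | good l]) tt) => n.
exact: (@leftmostP unit (fun l => [set _ | good l]) tt g0 gS n).
Qed.

(** * Universal measurability of Suslin sets *)

Section truncation.
Context d (X : measurableType d) (Q : seq nat -> set X).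
Hypothesis sQ : scheme Q.

Definition bounded_by (m l : seq nat) : Prop :=
  forall i, (i < size m)%N -> (nth 0%N l i <= nth 0%N m i)%N.

(** A measurable set around [bounded_branch m]: only a finite prefix is asked for, not a whole
    branch. *)
Definition trunc (m : seq nat) : set X :=
  [set x | exists l, [/\ size l = size m, bounded_by m l & Q l x]].

Definition bounded_branch (m : seq nat) : set X :=
  [set x | exists2 s, branch Q s x & bounded_by m (mkseq s (size m))].

Lemma bounded_branch_trunc m : bounded_branch m `<=` trunc m.
Proof. by move=> x [s Qs ms]; exists (mkseq s (size m)); split => //; exact: size_mkseq. Qed.

Lemma measurable_trunc m : measurable (trunc m).
Proof.
apply: (@measurable_by _ _ _ [set x | exists l,
    (size l = size m /\ bounded_by m l) /\ Q l x]).
  apply: measurable_ex => l; apply: measurable_and; first exact: measurable_const.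
  exact: sQ.1.
by move=> x; split=> [[l [? ? ?]]|[l [[? ?] ?]]]; exists l.
Qed.

Lemma trunc_le (t : baire) n n' : (n <= n')%N ->
  trunc (mkseq t n') `<=` trunc (mkseq t n).
Proof.
move=> nn' x [l []]; rewrite size_mkseq => sl lt Ql.
have sn : size (take n l) = n by rewrite size_takel// sl.
exists (take n l); split; first by rewrite size_mkseq.
  move=> i; rewrite size_mkseq => ilt; rewrite nth_take//.
  have := lt i; rewrite size_mkseq !nth_mkseq//; last exact: leq_trans nn'.
  by apply; exact: leq_trans nn'.
exact: scheme_take.
Qed.

(* Koenig's lemma: the tree of the [l] bounded by [t] with [x] in [Q l] is
   finitely branching. *)
Lemma trunc_branch (t : baire) : \bigcap_n trunc (mkseq t n) `<=`
  [set x | exists s, branch Q s x].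
Proof.
move=> x xt.
(* The tree of admissible sequences above [l] reaches every length. *)
pose good l := forall n, (size l <= n)%N -> exists l',
  [/\ size l' = n, bounded_by (mkseq t n) l', take (size l) l' = l & Q l' x].
have [| |s gs] := @dependent_branch good; last first.
- exists s => n; have [|l' [sl' _]] := gs n n; first by rewrite size_mkseq.
  by rewrite size_mkseq -sl' take_size => <-.
- move=> l gl; apply: contrapT => /forallNP nl.
  have /choice[h hP] k : exists n, ~ ((size (rcons l k) <= n)%N -> exists l',
      [/\ size l' = n, bounded_by (mkseq t n) l',
          take (size (rcons l k)) l' = rcons l k & Q l' x]).
    by apply/existsNP; exact: nl.
  (* [h k] is a length that child [k] does not reach. [n] is at least [h k] for each of the finitely
     many [k] allowed by [t], yet [l] has an admissible extension of length [n], which passes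
     through one of them. *)
  pose n := maxn (size l).+1 (\max_(k < (t (size l)).+1) h k).
  have [|l' [sl' l't ll' Ql']] := gl n.
    by rewrite /n (leq_trans _ (leq_maxl _ _)).
  have ln : (size l < n)%N by rewrite /n leq_maxl.
  have kt : (nth 0%N l' (size l) <= t (size l))%N.
    by have := l't (size l); rewrite size_mkseq nth_mkseq//; apply.
  set k := nth 0%N l' (size l) in kt.
  have hn : (h k <= n)%N.
    rewrite /n (leq_trans _ (leq_maxr _ _))//.
    by rewrite (@leq_bigmax _ (fun i : 'I_(t (size l)).+1 => h i) (Ordinal (kt : k < (t (size l)).+1)%N)).
  apply: (hP k) => lh; exists (take (h k) l'); split.
  + by rewrite size_takel// sl'.
  + move=> i; rewrite size_mkseq => ih; rewrite nth_take// nth_mkseq//.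
    have := l't i; rewrite size_mkseq nth_mkseq; last exact: leq_trans hn.
    by apply; exact: leq_trans hn.
  + rewrite take_takel// size_rcons (take_nth 0%N) ?sl'// ll'.
    by [].
  + exact: scheme_take.
- move=> n _; have [l [sl lt Ql]] := xt n I.
  by exists l; split => //; [rewrite sl size_mkseq|rewrite take0].
Qed.

End truncation.

Section outer_measure.
Context (R : realType) d (X : measurableType d) (P : {measure set X -> \bar R}).
Hypothesis P1 : P setT = 1.

Lemma unit_mass_fin_num A : measurable A -> P A \is a fin_num.
Proof.
move=> mA; rewrite ge0_fin_numE// (@le_lt_trans _ _ (P setT))//.
  by apply: le_measure; rewrite ?inE.
by rewrite P1 ltey.
Qed.

Lemma outer_unit_mass_lty A : (P^*)%mu A < +oo.
Proof.
apply: (@le_lt_trans _ _ ((P^*)%mu setT)); first exact: le_outer_measure.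
rewrite (_ : (P^*)%mu setT = 1) ?ltey//.
by rewrite measurable_mu_extE.
Qed.

(** The measurable hulls [B i] need not increase. Their tail intersections [C i] do, still contain
    [A i], and have measure at most that of [B i], which is the outer measure of [A i]. *)
Lemma outer_continuity (A : nat -> set X) (c : \bar R) :
  (forall i j, (i <= j)%N -> A i `<=` A j) ->
  c < (P^*)%mu [set x | exists i, A i x] -> exists i, c < (P^*)%mu (A i).
Proof.
move=> ndA; apply: contraPP => /forallNP nc; apply/negP; rewrite -leNgt.
have {}nc i : (P^*)%mu (A i) <= c by rewrite leNgt; apply/negP.
have /choice[B HB] i := mu_ext_hull (outer_unit_mass_lty (A i)).
pose C i := \bigcap_(j in [set j | (i <= j)%N]) B j.
have mC i : measurable (C i).
  by apply: bigcap_measurable => [|j _]; [exists i => /=|have [] := HB j].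
have ndC : nondecreasing_seq C.
  by move=> i j ij; apply/subsetPset => x Cx k /= jk; apply: Cx; exact: leq_trans jk.
have AC i : A i `<=` C i.
  by move=> x Ax j /= ij; have [_ + _] := HB j; apply; exact: ndA Ax.
apply: (@le_trans _ _ ((P^*)%mu (\bigcup_i C i))).
  by apply: le_outer_measure => x [i /AC Cx]; exists i.
have mUC : measurable (\bigcup_i C i) by exact: bigcup_measurable.
rewrite measurable_mu_extE//.
have cP := @nondecreasing_cvg_mu _ _ _ P _ mC mUC ndC.
rewrite -(cvg_lim _ cP)//; apply: lime_le; first exact: cvgP cP.
apply: nearW => i; apply: le_trans (nc i); have [mB _ <-] := HB i.
by apply: le_measure; rewrite ?inE//; apply: bigcap_inf => /=.
Qed.

(** The entries of [t] are chosen one at a time: [bounded_branch Q (rcons m k)] increases with [k]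
    to [bounded_branch Q m], so some [k] keeps the outer measure above [c]. *)
Lemma outer_trunc (Q : seq nat -> set X) (c : \bar R) :
  c < (P^*)%mu [set x | exists s, branch Q s x] ->
  exists t : baire, forall n, c < (P^*)%mu (trunc Q (mkseq t n)).
Proof.
move=> cP.
have [| |t tP] := @dependent_branch (fun m => c < (P^*)%mu (bounded_branch Q m)).
- apply: lt_le_trans cP _; apply: le_outer_measure => x [s Qs].
  by exists s.
- move=> m cm.
  apply: (@outer_continuity (fun k => bounded_branch Q (rcons m k))).
    move=> k k' kk' x [s Qs sm]; exists s => // i; rewrite size_rcons => im.
    have := sm i; rewrite !size_rcons => /(_ im) /leq_trans; apply.
    by rewrite !nth_rcons; case: ifP => // _; case: ifP.
  apply: lt_le_trans cm _; apply: le_outer_measure => x [s Qs sm].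
  exists (s (size m)), s => // i; rewrite size_rcons mkseqS.
  rewrite ltnS leq_eqVlt => /predU1P[->|im].
    by rewrite !nth_rcons size_mkseq ltnn eqxx.
  by rewrite !nth_rcons size_mkseq im; exact: sm.
exists t => n; apply: lt_le_trans (tP n) _; apply: le_outer_measure.
exact: bounded_branch_trunc.
Qed.

Lemma trunc_inner (Q : seq nat -> set X) (c : \bar R) (t : baire) : scheme Q ->
  (forall n, c <= P (trunc Q (mkseq t n))) ->
  c <= P (\bigcap_n trunc Q (mkseq t n)).
Proof.
move=> sQ ct; pose F n := trunc Q (mkseq t n).
have mF n : measurable (F n) by exact: measurable_trunc.
have mIF : measurable (\bigcap_n F n) by exact: bigcapT_measurable.
have cP : P (F n) @[n --> \oo] --> P (\bigcap_n F n).
  apply: nonincreasing_cvg_mu => //.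
    by rewrite -ge0_fin_numE// unit_mass_fin_num.
  by move=> i j ij; apply/subsetPset; exact: trunc_le.
rewrite -(cvg_lim _ cP)//; apply: lime_ge; last exact: nearW.
exact: cvgP cP.
Qed.

Lemma suslin_inner (A : set X) (c : \bar R) : suslin A -> c < (P^*)%mu A ->
  exists B, [/\ measurable B, B `<=` A & c <= P B].
Proof.
move=> /suslin_scheme[Q sQ ->] /outer_trunc[t ct].
exists (\bigcap_n trunc Q (mkseq t n)); split.
- by apply: bigcapT_measurable => n; exact: measurable_trunc.
- exact: trunc_branch.
- apply: trunc_inner => // n; rewrite -measurable_mu_extE ?ltW//.
  exact: measurable_trunc.
Qed.

End outer_measure.

(** The inner approximations exhaust the measure of the hull [C], so [A] lies between two measurable
    sets that differ by a null set. *)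
Lemma suslin_completion (R : realType) d (X : measurableType d)
    (P : {measure set X -> \bar R}) (A : set X) :
  P setT = 1 -> suslin A -> completion P A.
Proof.
move=> P1 sA; have Pfin := unit_mass_fin_num P1.
have [C [mC AC PC]] := mu_ext_hull (outer_unit_mass_lty P1 A).
have /choice[B HB] k : exists B, [/\ measurable B, B `<=` A &
    P C - (k.+1%:R^-1)%:E <= P B].
  have [P0|P0] := eqVneq (P C) 0.
    exists set0; split => //; rewrite P0 measure0 sub0e lee_fin oppr_le0.
    by rewrite invr_ge0.
  apply: (suslin_inner P1) => //; rewrite -PC lteBlDr// lteDl ?lte_fin ?invr_gt0//.
  by rewrite Pfin.
pose D := \bigcup_k B k.
have mD : measurable D by apply: bigcup_measurable => k _; have [] := HB k.
have DA : D `<=` A by move=> x [k _]; have [_ + _] := HB k; exact.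
have PCD : P (C `\` D) = 0.
  rewrite measureD//; last by rewrite -ge0_fin_numE// Pfin.
  rewrite setIidr; last exact: subset_trans AC.
  apply/eqP; rewrite eq_le; apply/andP; split; last first.
    rewrite sube_ge0 ?Pfin//; apply: le_measure; rewrite ?inE//.
    exact: subset_trans AC.
  rewrite leeBlDr ?Pfin// add0e; apply/lee_addgt0Pr => e e0.
  have [k] := ltr_add_invr e0; rewrite add0r => ke.
  have [mB _] := HB k; rewrite leeBlDr// => /le_trans; apply.
  apply: leeD; last by rewrite lee_fin ltW.
  by apply: le_measure; rewrite ?inE//; exact: bigcup_sup.
exists C => //; exists (C `\` D); split => //; first exact: measurableD.
by move=> x [[/AC Cx nC]//|[Cx nA]]; split => // /DA.
Qed.

Lemma suslin_universally_measurable (R : realType) d (X : measurableType d)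
    (A : set X) : suslin A -> universally_measurable R A.
Proof. by move=> sA P; apply: suslin_completion => //; exact: probability_setT. Qed.

(** The section has outer measure above [c] iff some rational [q > c] and some [t : baire] satisfy
    [q <= k x (trunc ...)] at every depth, by [outer_trunc] in one direction and [trunc_inner] in
    the other. This is measurable in [(x, t)], so [t] serves as the branch. The rational [q] keeps
    the inequality strict, as the limit over depths only preserves weak ones. *)
Theorem suslin_kernel (R : realType) d d' (X : measurableType d)
    (W : measurableType d') (k : R.-pker X ~> W) (A : set (X * W)) (c : R) :
  suslin A -> suslin [set x | c%:E < ((k x)^*)%mu [set w | A (x, w)]].
Proof.
move=> /suslin_scheme[Q sQ ->].
have k1 x : k x setT = 1 by exact: prob_kernel.
pose Qx x (l : seq nat) := [set w | Q l (x, w)].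
have sQx x : scheme (Qx x).
  split => [l|l j w]; last exact: sQ.2.
  exact: (measurable_preim (measurable_fun_pair (@measurable_cst _ _ W X setT x)
    (@measurable_id _ W setT)) (sQ.1 l)).
have kxsec x m : k x (trunc (Qx x) m) = k x (xsection (trunc Q m) x).
  by congr (k x _); apply/seteqP; split => w; rewrite /xsection/= inE.
pose S (q : rat) := [set x : X | (c < ratr q)%R /\ exists t : baire,
  forall n, (ratr q)%:E <= k x (xsection (trunc Q (mkseq t n)) x)].
rewrite (_ : [set x | _] = [set x | exists q, S q x]).
  apply: suslin_countex => q; apply: suslin_and.
    by apply: suslin_measurable; exact: measurable_const.
  exists [set p : X * baire | forall n,
      ((ratr q)%:E <= k p.1 (xsection (trunc Q (mkseq p.2 n)) p.1))] => //.
  apply: measurable_all => n.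
  apply: (@measurable_by _ _ _ [set p : X * baire | exists l, mkseq p.2 n = l /\
      (ratr q)%:E <= k p.1 (xsection (trunc Q l) p.1)]); last first.
    by move=> [x t] /=; split => [|[_ [<-]]]//; exists (mkseq t n).
  apply: measurable_ex => l; apply: measurable_and.
    exact: (measurable_preim (@measurable_snd _ _ X baire) (measurable_mkseq n l)).
  have mk : measurable_fun setT (fun x => k x (xsection (trunc Q l) x)).
    have := @measurable_fun_xsection_finite_kernel _ _ X W R k (trunc Q l).
    by rewrite inE => /(_ (measurable_trunc sQ l)).
  have mk1 := measurableT_comp mk (@measurable_fst _ _ X baire).
  by have := emeasurable_fun_c_infty measurableT mk1 ((ratr q)%:E); rewrite setTI.
apply/seteqP; split => x /=.
  move=> cA.
  have [q /andP[cq qA]] : exists q : rat, c%:E < (ratr q)%:E < ((k x)^*)%mu [set w | exists s, branch (Qx x) s w].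
    have Afin : ((k x)^*)%mu [set w | exists s, branch (Qx x) s w] \is a fin_num.
      rewrite ge0_fin_numE ?mu_ext_ge0//; exact: outer_unit_mass_lty.
    move: cA; rewrite -[X in _ < X](fineK Afin) lte_fin => /rat_in_itvoo[q].
    by rewrite in_itv/= => qA; exists q; rewrite -(fineK Afin) !lte_fin.
  exists q; split; first by rewrite -lte_fin.
  have [t tP] := outer_trunc (k1 x) qA.
  exists t => n; rewrite -kxsec -measurable_mu_extE ?ltW//.
  exact: measurable_trunc.
move=> [q [cq [t tP]]].
have : (ratr q)%:E <= k x (\bigcap_n trunc (Qx x) (mkseq t n)).
  by apply: trunc_inner => // n; rewrite kxsec.
rewrite -measurable_mu_extE; last first.
  by apply: bigcapT_measurable => n; exact: measurable_trunc.
move=> /(lt_le_trans _) qk; apply: (lt_le_trans (qk c%:E _)); first by rewrite lte_fin.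
exact/le_outer_measure/trunc_branch.
Qed.

(** * Measurable selection *)

(** [measurable_leftmost] is applied to the completed sigma-field of [P] as a measurable type of its
    own. *)
Lemma completion_leftmost (R : realType) d (X : measurableType d)
    (B : seq nat -> set X) (P : probability X R) n k :
  (forall l, universally_measurable R (B l)) ->
  completion P [set x | leftmost B x n = k].
Proof.
move=> uB; apply/completionE.
apply: (@measurable_leftmost _ (caratheodory_type (P^*)%mu) B n k) => l.
exact/completionE/uB.
Qed.

Lemma measurable_fun_cara (R : realType) d d' (X : measurableType d)
    (Y : measurableType d') (P : probability X R) (g : X -> Y) :
  measurable_fun (setT : set (caratheodory_type (P^*)%mu))
    (g : caratheodory_type (P^*)%mu -> Y) <->
  (forall D, measurable D -> completion P (g @^-1` D)).
Proof.
split=> [mg D mD|cg _ D mD]; last by rewrite setTI; exact/completionE/cg.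
by apply/completionE; have := mg measurableT _ mD; rewrite setTI.
Qed.

Lemma branch_selection (R : realType) d (X : measurableType d)
    (G : set (X * baire)) : measurable G ->
  exists2 g : X -> baire,
    forall D, measurable D -> universally_measurable R (g @^-1` D) &
    forall x t, G (x, t) -> G (x, g x).
Proof.
move=> /suslin_normal_form[Q sQ GQ].
(* The points having a branch of [Q] through [l]. With these sets, rather than with [Q] itself, the
   leftmost choice never gets stuck; they are Suslin, hence universally measurable. *)
pose B l := [set x | exists s, mkseq s (size l) = l /\ branch Q s x].
have uB l : universally_measurable R (B l).
  apply: suslin_universally_measurable.
  exists [set p : X * baire | mkseq p.2 (size l) = l /\ branch Q p.2 p.1] => //.
  apply: measurable_and; last exact: measurable_branch.
  exact: (measurable_preim (@measurable_snd _ _ X baire) (measurable_mkseq _ l)).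
exists (slice 0 \o leftmost B).
  move=> D mD P; apply/completionE; apply/(completionE P).
  move: D mD; apply/measurable_fun_cara.
  apply: (measurableT_comp (measurable_slice 0)).
  by apply: measurable_fun_baire => n k; apply/completionE/completion_leftmost.
move=> x t /GQ[s _ Qs]; apply/GQ; exists (leftmost B x) => //.
have BL : branch B (leftmost B x) x.
  apply: leftmostP; first by exists s.
  move=> l [s' [s'l Qs']]; exists (s' (size l)), s'.
  by rewrite size_rcons mkseqS s'l.
by move=> n; have [s' []] := BL n; rewrite size_mkseq => <-.
Qed.

Theorem suslin_selection (R : realType) d d' (X : measurableType d)
    (U : measurableType d') (A : set (X * U)) :
  baire_image U -> suslin A ->
  exists g : umfun R X U, forall x u, A (x, u) -> A (x, g x).
Proof.
move=> [p mp psurj] [G mG ->].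
(* The code of [u] ([slice 0]) and the witness of membership ([slice 1]) are selected together, in
   one branch. *)
have mG' : measurable [set q | G ((q.1, p (slice 0 q.2)), slice 1 q.2)].
  apply: measurable_preim mG.
  have m2 := @measurable_snd _ _ X baire.
  apply: measurable_fun_pair; last exact: (measurableT_comp (measurable_slice 1)).
  apply: measurable_fun_pair; first exact: measurable_fst.
  apply: (measurableT_comp mp).
  exact: (measurableT_comp (measurable_slice 0)).
have [g ug gP] := branch_selection R mG'.
have ug' D : measurable D -> universally_measurable R ((p \o slice 0 \o g) @^-1` D).
  move=> mD; apply: (ug [set s | D (p (slice 0 s))]).
  exact: (measurable_preim (measurableT_comp mp (measurable_slice 0))).
exists (UMFun ug') => x u [s Gs] /=; exists (slice 1 (g x)).
have [t pt] := psurj u.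
have [s' s'E] := slice_surj (fun j => if j is 0%N then t else s).
by apply: (gP x s'); rewrite /= !s'E pt.
Qed.

(** * Functions with Suslin sublevel sets *)

Section lsa.
Context (R : realType).

Definition lsa d (X : measurableType d) (phi : X -> \bar R) : Prop :=
  forall c : R, suslin [set x | phi x < c%:E].

Lemma eq_lsa d (X : measurableType d) (phi psi : X -> \bar R) :
  (forall x, phi x = psi x) -> lsa phi -> lsa psi.
Proof. by move=> e; rewrite (_ : phi = psi)//; apply/funext. Qed.

Lemma lower_semianalytic_lsa d (X : measurableType d) (phi : X -> \bar R) :
  countably_separated X -> lower_semianalytic phi -> lsa phi.
Proof. by move=> sX lphi c; exact: analytic_suslin (lphi c). Qed.

Lemma lsa_cst d (X : measurableType d) (a : \bar R) : lsa (fun _ : X => a).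
Proof. by move=> c; apply: suslin_measurable; exact: measurable_const. Qed.

Lemma lsa_comp d d' (X : measurableType d) (Y : measurableType d')
    (phi : Y -> \bar R) (f : X -> Y) :
  measurable_fun setT f -> lsa phi -> lsa (fun x => phi (f x)).
Proof. by move=> mf lphi c; exact: (suslin_preimage mf (lphi c)). Qed.

Lemma ereal_rat_between (a b : \bar R) :
  a < b -> exists q : rat, a < (ratr q)%:E < b.
Proof.
have H (r s : R) : (r < s)%R -> exists q : rat, r%:E < (ratr q)%:E < s%:E.
  by move=> /rat_in_itvoo[q]; rewrite in_itv/= => qrs; exists q; rewrite !lte_fin.
case: a => [r| |]; case: b => [s| |]//.
- by rewrite lte_fin; exact: H.
- move=> _; have [|q /andP[rq _]] := H r (r + 1)%R; first by rewrite ltrDl.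
  by exists q; rewrite rq ltey.
- move=> _; have [|q /andP[_ qs]] := H (s - 1)%R s; first by rewrite ltrBlDr ltrDl.
  by exists q; rewrite qs ltNye.
- by exists 0%R; rewrite ltNye ltey.
Qed.

Lemma lsa_add d (X : measurableType d) (phi psi : X -> \bar R) :
  (forall x, 0 <= phi x) -> (forall x, 0 <= psi x) ->
  lsa phi -> lsa psi -> lsa (fun x => phi x + psi x).
Proof.
move=> phi0 psi0 lphi lpsi c.
rewrite (_ : [set x | _] = [set x | exists q : rat,
    phi x < (ratr q)%:E /\ psi x < (c - ratr q)%:E]).
  apply: suslin_countex => q; apply: suslin_and; [exact: lphi|exact: lpsi].
apply/seteqP; split => x /=.
  move=> s; have psif : psi x \is a fin_num.
    rewrite ge0_fin_numE//; apply: le_lt_trans (lt_trans s (ltry c)).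
    exact: leeDr.
  have : phi x < c%:E - psi x by rewrite lteBrDr.
  move=> /ereal_rat_between[q /andP[q1 q2]]; exists q; split => //.
  by rewrite EFinB lteBrDr// addeC -lteBrDr.
move=> [q [q1 q2]].
have -> : c = (ratr q + (c - ratr q))%R by rewrite addrC subrK.
by rewrite EFinD; apply: lteD.
Qed.

Lemma lsa_sum d (X : measurableType d) (phi : nat -> X -> \bar R) n :
  (forall k x, 0 <= phi k x) -> (forall k, lsa (phi k)) ->
  lsa (fun x => \sum_(k < n) phi k x).
Proof.
move=> phi0 lphi; elim: n => [|n IH].
  by apply: eq_lsa (@lsa_cst _ _ 0) => x; rewrite big_ord0.
apply: eq_lsa (lsa_add _ _ IH (lphi n)) => // x; first by rewrite big_ord_recr.
exact: sume_ge0.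
Qed.

Lemma lsa_sup d (X : measurableType d) (phi : nat -> X -> \bar R) :
  (forall k, lsa (phi k)) -> lsa (fun x => ereal_sup [set phi k x | k in setT]).
Proof.
move=> lphi c.
rewrite (_ : [set x | _] = [set x | exists q : rat,
    (ratr q)%:E < c%:E /\ forall k, phi k x < (ratr q)%:E]).
  apply: suslin_countex => q; apply: suslin_and.
    by apply: suslin_measurable; exact: measurable_const.
  by apply: suslin_all => k; exact: lphi.
apply/seteqP; split => x /=.
  move=> /ereal_rat_between[q /andP[q1 q2]]; exists q; split => // k.
  by apply: le_lt_trans q1; apply: ereal_sup_ubound; exists k.
move=> [q [qc qP]]; apply: le_lt_trans qc; apply: ge_ereal_sup => _ [k _ <-].
exact: ltW.
Qed.

Lemma lsa_inf d d' (X : measurableType d) (Y : measurableType d')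
    (phi : X * Y -> \bar R) : baire_image Y -> lsa phi ->
  lsa (fun x => ereal_inf [set phi (x, y) | y in setT]).
Proof.
move=> bY lphi c.
rewrite (_ : [set x | _] = [set x | exists y, phi (x, y) < c%:E]).
  exact: (suslin_proj bY (lphi c)).
apply/seteqP; split => x /=; first by move=> /ereal_inf_lt[_ [y _ <-]]; exists y.
by move=> [y]; apply: le_lt_trans; apply: ereal_inf_lbound; exists y.
Qed.

Lemma least_unique (P : nat -> Prop) (k k' : nat) :
  P k /\ (forall i, (i < k)%N -> ~ P i) ->
  P k' /\ (forall i, (i < k')%N -> ~ P i) -> k = k'.
Proof.
move=> [Pk kmin] [Pk' k'min]; apply/eqP; rewrite eqn_leq.
by apply/andP; split; rewrite leqNgt; apply/negP; [move/kmin|move/k'min]; apply.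
Qed.

Lemma measurable_least d (T : measurableType d) (A : nat -> set T) k :
  (forall i, measurable (A i)) ->
  measurable [set x | A k x /\ forall i, (i < k)%N -> ~ A i x].
Proof.
move=> mA; apply: measurable_and => //; apply: measurable_all => i.
by apply: measurable_imply; [exact: measurable_const|exact: measurableC].
Qed.

(** The range of the infimum [J] is cut into intervals of length [e]. Where [k] is least with
    [J x < (k + 1) e], a selector of {phi < (k + 1) e} is optimal up to [e]; where [J x] is infinite
    any control will do. *)
Theorem lsa_selection d d' (X : measurableType d) (U : measurableType d')
    (phi : X * U -> \bar R) (e : R) : baire_image U -> (0 < e)%R ->
  (forall p, 0 <= phi p) -> lsa phi ->
  exists g : umfun R X U, forall x,
    phi (x, g x) <= ereal_inf [set phi (x, u) | u in setT] + e%:E.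
Proof.
move=> bU e0 phi0 lphi.
pose J x := ereal_inf [set phi (x, u) | u in setT].
pose b (k : nat) : R := (k.+1%:R * e)%R.
have J0 x : 0 <= J x by apply: le_ereal_inf_tmp => _ [u _ <-].
have lJ : lsa J by exact: lsa_inf.
have /choice[G GP] k := suslin_selection R bU (lphi (b k)).
pose small k x := J x < (b k)%:E.
pose least k x := small k x /\ forall i, (i < k)%N -> ~ small i x.
have exleast x : J x < +oo -> exists k, least k x.
  move=> Jfin; have Jf : J x \is a fin_num by rewrite ge0_fin_numE.
  have ex : exists k, `[<small k x>].
    exists (Num.bound (fine (J x) / e)); apply/asboolP.
    rewrite /small /b -(fineK Jf) lte_fin -ltr_pdivrMr//.
    apply: (@lt_le_trans _ _ (Num.bound (fine (J x) / e))%:R).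
      by apply: archi_boundP; rewrite divr_ge0 ?fine_ge0// ltW.
    by rewrite ler_nat.
  exists (ex_minn ex); case: ex_minnP => k /asboolP ks kmin; split => // i ik.
  by move=> /asboolP/kmin; rewrite leqNgt ik.
have least_uniq x k k' : least k x -> least k' x -> k = k'.
  exact: (@least_unique (fun i => small i x)).
pose g x := if pselect (exists k, least k x) is left h
  then G (projT1 (cid h)) x else point.
have gE x k : least k x -> g x = G k x.
  rewrite /g => kx; case: pselect => [h|]; last by case; exists k.
  by case: cid => k' k'x /=; rewrite (least_uniq _ _ _ kx k'x).
have ug D : measurable D -> universally_measurable R (g @^-1` D).
  move=> mD P; apply/completionE; rewrite -[measurable _]/(measurable (_ : set (caratheodory_type (P^*)%mu))).
  have msmall k : measurable ([set x | small k x] : set (caratheodory_type (P^*)%mu)).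
    exact/completionE/suslin_universally_measurable/lJ.
  have mleast k : measurable ([set x | least k x] : set (caratheodory_type (P^*)%mu)).
    exact: (@measurable_least _ (caratheodory_type (P^*)%mu) small).
  apply: (@measurable_by _ (caratheodory_type (P^*)%mu) _ [set x |
     (exists k, least k x /\ D (G k x)) \/ ((forall k, ~ least k x) /\ D point)]).
    apply: measurableU.
      apply: measurable_ex => k; apply: measurable_and; first exact: mleast.
      by apply/completionE; apply: umfunP.
    apply: measurable_and; last exact: measurable_const.
    by apply: measurable_all => k; apply: measurableC; exact: mleast.
  move=> x; have [[k kx]|nx] := pselect (exists k, least k x).
    rewrite /preimage/= (gE _ _ kx); split => [Dx|]; first by left; exists k.
    by move=> [[k' [k'x]]|[/(_ k)]//]; rewrite (least_uniq _ _ _ kx k'x).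
  rewrite /preimage/= /g; case: pselect => // _; split => [Dp|].
    by right; split => // k kx; apply: nx; exists k.
  by move=> [[k [kx _]]|[]//]; exfalso; apply: nx; exists k.
exists (UMFun ug) => x /=; rewrite -/(J x).
have [Jfin|] := ltP (J x) +oo; last first.
  by rewrite leye_eq => /eqP ->; rewrite addye// leey.
have [k kx] := exleast x Jfin; rewrite (gE _ _ kx).
have [+ kmin] := kx; move=> /ereal_inf_lt[_ [u _ <-]] /GP /= Gk.
apply: (le_trans (ltW Gk)).
(* At level 0 the bound is [e] itself and [J x >= 0]; above it, minimality of the level gives
   [b k <= J x]. *)
case: k kmin {kx} Gk => [|k] kmin Gk.
  by rewrite /b mul1r; exact: leeDr.
have /negP := kmin k (ltnSn k); rewrite -leNgt => bJ.
rewrite (_ : b k.+1 = b k + e)%R; last by rewrite /b -[in LHS]natr1 mulrDl mul1r.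
by rewrite EFinD leeD2r.
Qed.

End lsa.

(** * Completed integrals *)

(** Holds for arbitrary nonnegative functions, the integral being a supremum over the simple
    functions below. Iterated integrals can thus be compared whatever the measurability of the inner
    one. *)
Lemma ge0_integral_le (R : realType) d (X : measurableType d)
    (m : {measure set X -> \bar R}) (f g : X -> \bar R) :
  (forall x, 0 <= f x) -> (forall x, f x <= g x) ->
  \int[m]_x f x <= \int[m]_x g x.
Proof.
move=> f0 fg; have g0 x : 0 <= g x by exact: le_trans (f0 x) (fg x).
rewrite !ge0_integralE// !patch_setT; apply: le_ereal_sup.
by move=> _ [h /= hf <-]; exists h => // x; exact: le_trans (hf x) (fg x).
Qed.

Lemma measurable_fun_lt (R : realType) d (X : measurableType d)
    (f : X -> \bar R) :
  (forall c : R, measurable [set x | f x < c%:E]) -> measurable_fun setT f.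
Proof.
move=> mf; apply: (measurability _ (ErealGenInftyO.measurableE R)).
move=> _ [_ [r ->] <-]; rewrite setTI.
by apply: measurable_by (mf r) _ => x; rewrite /preimage/= in_itv.
Qed.

Lemma negligible_ex (R : realType) d (X : measurableType d)
    (mu : {measure set X -> \bar R}) (I : countType) (A : I -> set X) :
  (forall i, mu.-negligible (A i)) -> mu.-negligible [set x | exists i, A i x].
Proof.
move=> nA; apply: (@negligibleS _ _ _ _
  (\bigcup_k (if unpickle k is Some i then A i else set0))).
  by move=> x [i Ai]; exists (pickle i) => //; rewrite pickleK.
by apply: negligible_bigcup => k; case: unpickle => // ; exact: negligible_set0.
Qed.

Lemma exists_pushforward (R : realType) d1 d2 (Y : measurableType d1)
    (Z : measurableType d2) (mu : {measure set Y -> \bar R}) (F : Y -> Z) :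
  measurable_fun setT F -> exists m : {measure set Z -> \bar R},
    (forall A, m A = mu (F @^-1` A)) /\
    forall f, measurable_fun setT f -> (forall z, 0 <= f z) ->
      \int[m]_z f z = \int[mu]_y f (F y).
Proof.
move=> mF; have := ge0_integral_pushforward mF mu measurableT.
rewrite preimage_setT => H.
unshelve eexists (pushforward mu F : {measure set Z -> \bar R}); first exact: mF.
by split => // f mf f0; apply: H.
Qed.

Section cintegral.
Context (R : realType) d (X : measurableType d).
Implicit Types (mu nu : {measure set X -> \bar R}) (f g phi : X -> \bar R).

Lemma cintegral_ge0 mu f : (forall x, 0 <= f x) -> 0 <= cintegral mu f.
Proof. by move=> f0; exact: integral_ge0. Qed.

Lemma le_cintegral mu f g :
  (forall x, 0 <= f x) -> (forall x, f x <= g x) ->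
  cintegral mu f <= cintegral mu g.
Proof.
exact: (@ge0_integral_le _ _ (caratheodory_type (mu^*)%mu)
  (@completed_measure_extension _ _ _ mu)).
Qed.

Lemma eq_cintegral mu f g : f =1 g -> cintegral mu f = cintegral mu g.
Proof. by move=> fg; apply: eq_integral => x _. Qed.

Lemma measurable_cara_id mu : measurable_fun
  (setT : set (caratheodory_type (mu^*)%mu)) (fun x : caratheodory_type (mu^*)%mu => x : X).
Proof. by move=> _ A mA; rewrite setTI; exact: caratheodory_of_measurable. Qed.

Lemma cintegral_measurable mu f : measurable_fun setT f ->
  (forall x, 0 <= f x) -> cintegral mu f = \int[mu]_x f x.
Proof.
move=> mf f0.
have [m [mE mI]] := exists_pushforward (@completed_measure_extension _ _ _ mu)
  (@measurable_cara_id mu).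
rewrite /cintegral -mI//; apply: eq_measure_integral => A mA _.
by rewrite mE; exact: measurable_mu_extE.
Qed.

Definition completion_measurable mu f : Prop :=
  forall c : R, completion mu [set x | f x < c%:E].

Lemma completion_measurable_cara mu f : completion_measurable mu f ->
  measurable_fun (setT : set (caratheodory_type (mu^*)%mu)) f.
Proof.
by move=> cf; apply: measurable_fun_lt => c; exact: completion_caratheodory.
Qed.

Lemma lsa_completion_measurable mu f : mu setT = 1 -> lsa f ->
  completion_measurable mu f.
Proof. by move=> mu1 lf c; exact: suslin_completion. Qed.

(** For each rational level the sublevel set agrees with a measurable one off a null set. Off the
    union [N] of these null sets [f] is measurable; on [N] the bounds are 0 and [+oo]. *)
Lemma completion_sandwich mu f : (forall x, 0 <= f x) ->
  completion_measurable mu f -> exists f1 f2,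
  [/\ measurable_fun setT f1, measurable_fun setT f2,
      forall x, 0 <= f1 x, forall x, f1 x <= f x <= f2 x &
      exists N, [/\ measurable N, mu N = 0 & forall x, ~ N x -> f1 x = f2 x]].
Proof.
move=> f0 cf.
have /choice[B /choice[M BM]] q : exists B M, [/\ measurable B, measurable M,
    mu M = 0 & [set x | f x < (ratr q)%:E] `+` B `<=` M].
  by have [B mB [M [mM M0 BM]]] := cf (ratr q); exists B, M.
pose N := [set x | exists q, M q x].
have mN : measurable N by apply: measurable_ex => q; have [] := BM q.
have N0 : mu N = 0.
  apply: measure_negligible => //; apply: negligible_ex => q.
  by have [_ mM M0 _] := BM q; exists (M q); split.
have offN c : measurable [set x | ~ N x /\ f x < c%:E].
  apply: (@measurable_by _ _ _ [set x | ~ N x /\ exists q : rat, (ratr q <= c)%R /\ B q x]).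
    apply: measurable_and; first exact: measurableC.
    apply: measurable_ex => q; apply: measurable_and; first exact: measurable_const.
    by have [] := BM q.
  have fB x q : ~ N x -> f x < (ratr q)%:E <-> B q x.
    move=> nN; have [_ _ _ sM] := BM q.
    have nM : ~ M q x by move=> Mq; apply: nN; exists q.
    by split => h; apply: contrapT => nh; apply: nM; apply: sM; [left|right].
  move=> x; split => -[nN].
    move=> /ereal_rat_between[q /andP[fq qc]]; split => //; exists q.
    by split; [rewrite -lee_fin ltW|exact/fB].
  move=> [q [qc /fB fq]]; split => //; apply: (lt_le_trans (fq nN)).
  by rewrite lee_fin.
pose fN a x := if pselect (N x) then a else f x : \bar R.
have mfN a : measurable_fun setT (fN a).
  apply: measurable_fun_lt => c.
  apply: (@measurable_by _ _ _ [set x | (~ N x /\ f x < c%:E) \/ (N x /\ a < c%:E)]).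
    apply: measurableU; first exact: offN.
    by apply: measurable_and; [exact: mN|exact: measurable_const].
  by move=> x; rewrite /= /fN; case: (pselect (N x)) => /= ?; tauto.
exists (fN 0), (fN +oo); split => //.
- by move=> x; rewrite /fN; case: (pselect (N x)) => /= _; rewrite ?f0 ?lexx.
- by move=> x; rewrite /fN; case: (pselect (N x)) => /= _; rewrite ?f0 ?leey ?lexx.
- by exists N; split => // x nN; rewrite /fN; case: (pselect (N x)).
Qed.

Lemma cintegral_sandwich mu f f1 f2 N :
  measurable_fun setT f1 -> measurable_fun setT f2 ->
  (forall x, 0 <= f1 x) -> (forall x, f1 x <= f x <= f2 x) ->
  measurable N -> mu N = 0 -> (forall x, ~ N x -> f1 x = f2 x) ->
  cintegral mu f = \int[mu]_x f1 x /\ \int[mu]_x f1 x = \int[mu]_x f2 x.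
Proof.
move=> mf1 mf2 f10 f12 mN N0 eqN.
have f0 x : 0 <= f x by apply: le_trans (f10 x) _; have /andP[] := f12 x.
have f20 x : 0 <= f2 x by apply: le_trans (f0 x) _; have /andP[] := f12 x.
have e : \int[mu]_x f1 x = \int[mu]_x f2 x.
  apply: ge0_ae_eq_integral => //; exists N; split => //.
  by move=> x /= /not_implyP[_ h]; apply: contrapT => /eqN.
split => //; apply/eqP; rewrite eq_le; apply/andP; split.
  rewrite e -cintegral_measurable//; apply: le_cintegral => // x.
  by have /andP[] := f12 x.
rewrite -cintegral_measurable//; apply: le_cintegral => // x.
by have /andP[] := f12 x.
Qed.

(** Compatible kernels are equal on measurable sets only, whereas [cintegral] is built from the
    outer measure of the given measure; the sandwich bridges this. *)
Lemma eq_measure_cintegral mu nu f :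
  (forall A, measurable A -> mu A = nu A) -> (forall x, 0 <= f x) ->
  completion_measurable mu f -> cintegral mu f = cintegral nu f.
Proof.
move=> munu f0 /(completion_sandwich f0)[f1 [f2 [mf1 mf2 f10 f12 [N [mN N0 eqN]]]]].
have [-> _] := cintegral_sandwich mf1 mf2 f10 f12 mN N0 eqN.
have [|-> _] := @cintegral_sandwich nu f f1 f2 N mf1 mf2 f10 f12 mN _ eqN.
  by rewrite -munu.
by apply: eq_measure_integral => A mA _; exact: munu.
Qed.

Lemma completed_setT mu : @completed_measure_extension _ _ _ mu setT = mu setT.
Proof. exact: measurable_mu_extE. Qed.

Lemma cintegral_cst_add mu f (a : \bar R) : mu setT = 1 -> 0 <= a ->
  (forall x, 0 <= f x) -> completion_measurable mu f ->
  cintegral mu (fun x => a + f x) = a + cintegral mu f.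
Proof.
move=> mu1 a0 f0 /completion_measurable_cara mf.
rewrite /cintegral ge0_integralD//=.
by rewrite integral_cst//= completed_setT mu1 mule1.
Qed.

End cintegral.

(** A null set of the Dirac mass misses [x], so both bounds of the sandwich equal [f x] there. *)
Lemma cintegral_dirac (R : realType) d (X : measurableType d) (x : X)
    (f : X -> \bar R) : (forall x, 0 <= f x) ->
  completion_measurable (dirac x) f -> cintegral (dirac x : {measure set X -> \bar R}) f = f x.
Proof.
move=> f0 cf.
have [f1 [f2 [mf1 mf2 f10 f12 [N [mN N0 eqN]]]]] := completion_sandwich f0 cf.
have [-> _] := cintegral_sandwich mf1 mf2 f10 f12 mN N0 eqN.
rewrite integral_dirac// diracT mul1e.
have nN : ~ N x.
  move=> Nx; have : (\d_x N : \bar R) = 0 := N0.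
  by rewrite diracE mem_set//= => /eqP; rewrite onee_eq0.
apply/eqP; rewrite eq_le; have /andP[-> fx] /= := f12 x.
by rewrite eqN.
Qed.

(** * Integrals of functions with Suslin sublevel sets *)

Section staircase.
Variable R : realType.
Implicit Types (y : \bar R) (a z : R).

(** For [a > 0] and [y >= 0] this is [a] times the minimum of [n] and the integer part of [y / a].
    As a sum of steps it integrates to a finite sum of measures of superlevel sets. *)
Definition staircase a (n : nat) y : R :=
  \sum_(k < n) (if ((k.+1%:R * a)%:E <= y)%E then a else 0%R).

Lemma staircaseS a n y :
  staircase a n.+1 y = (staircase a n y + if ((n.+1%:R * a)%:E <= y)%E then a else 0)%R.
Proof. by rewrite /staircase big_ord_recr. Qed.

Lemma staircase_ge0 a n y : (0 <= a)%R -> (0 <= staircase a n y)%R.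
Proof. by move=> a0; apply: sumr_ge0 => k _; case: ifP. Qed.

Lemma staircase_full a n y : (0 <= a)%R ->
  (n%:R * a)%:E <= y -> staircase a n y = (n%:R * a)%R.
Proof.
move=> a0; elim: n => [|n IH] ny; first by rewrite /staircase big_ord0 mul0r.
rewrite staircaseS ny IH -?[in RHS]natr1 ?mulrDl ?mul1r//.
by apply: le_trans ny; rewrite lee_fin ler_wpM2r// ler_nat.
Qed.

Lemma staircase_le a n y : (0 <= a)%R -> 0 <= y -> (staircase a n y)%:E <= y.
Proof.
move=> a0 y0; elim: n => [|n IH]; first by rewrite /staircase big_ord0.
have [ny|ny] := boolP ((n.+1%:R * a)%:E <= y); first by rewrite staircase_full.
by rewrite staircaseS (negbTE ny) addr0.
Qed.

Lemma staircase_approx a n y z : (0 <= a)%R -> (z <= n%:R * a)%R -> z%:E <= y ->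
  (z <= staircase a n y + a)%R.
Proof.
move=> a0; elim: n => [|n IH] zn zy.
  by rewrite /staircase big_ord0 add0r; apply: le_trans zn _; rewrite mul0r.
have [ny|ny] := boolP ((n.+1%:R * a)%:E <= y).
  by rewrite staircase_full// (le_trans zn)// lerDl.
rewrite staircaseS (negbTE ny) addr0.
have [zn'|zn'] := leP z (n%:R * a)%R; first exact: IH.
rewrite staircase_full//; first by move: zn; rewrite -natr1 mulrDl mul1r.
by apply: le_trans zy; rewrite lee_fin ltW.
Qed.

Definition superlevel (T : Type) (f : T -> \bar R) a : set T :=
  [set t | a%:E <= f t].

Lemma measurable_superlevel d (T : measurableType d) (f : T -> \bar R) a :
  measurable_fun setT f -> measurable (superlevel f a).
Proof.
by move=> mf; have := emeasurable_fun_c_infty measurableT mf a%:E; rewrite setTI.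
Qed.

Lemma staircase_indic (T : Type) (f : T -> \bar R) a n t :
  (staircase a n (f t))%:E =
  \sum_(k < n) a%:E * (\1_(superlevel f (k.+1%:R * a)%R) t)%:E.
Proof.
rewrite /staircase -sumEFin; apply: eq_bigr => k _.
rewrite -EFinM indicE; case: ifPn => kf; first by rewrite mem_set// mulr1.
by rewrite memNset ?mulr0//; exact/negP.
Qed.

Lemma measurable_staircase_term d (T : measurableType d) (f : T -> \bar R) a k :
  measurable_fun setT f ->
  measurable_fun setT (fun t => a%:E * (\1_(superlevel f (k.+1%:R * a)%R) t)%:E).
Proof.
move=> mf; apply: measurable_funeM; apply/measurable_EFinP/measurable_indic.
exact: measurable_superlevel.
Qed.

Lemma measurable_staircase d (T : measurableType d) (f : T -> \bar R) a n :
  measurable_fun setT f -> measurable_fun setT (fun t => (staircase a n (f t))%:E).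
Proof.
move=> mf; under eq_fun do rewrite staircase_indic.
by apply: emeasurable_sum => k; exact: measurable_staircase_term.
Qed.

Lemma integral_staircase d (T : measurableType d) (m : {measure set T -> \bar R})
    (f : T -> \bar R) a n : (0 <= a)%R -> measurable_fun setT f ->
  \int[m]_t (staircase a n (f t))%:E =
  \sum_(k < n) a%:E * m (superlevel f (k.+1%:R * a)%R).
Proof.
move=> a0 mf.
have mA k : measurable (superlevel f (k.+1%:R * a)%R).
  exact: measurable_superlevel.
under eq_integral do rewrite staircase_indic.
rewrite ge0_integral_sum//.
- apply: eq_bigr => k _; rewrite ge0_integralZl_EFin//.
  + by rewrite integral_indic// setIT.
  + exact/measurable_EFinP/measurable_indic.
- by move=> k; exact: measurable_staircase_term.
- by move=> k t _; rewrite -EFinM lee_fin mulr_ge0.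
Qed.

Import HBSimple HBNNSimple.

(** [(n + 1)^2] steps of height [1 / (n + 1)] reach up to [n + 1], so range and precision improve
    together. A simple function below [f] is bounded, hence at most a fine staircase plus its step
    height, whose integral is that height since the mass is 1. *)
Lemma integral_staircase_sup d (T : measurableType d)
    (m : {measure set T -> \bar R}) (f : T -> \bar R) : m setT = 1 ->
  measurable_fun setT f -> (forall t, 0 <= f t) ->
  \int[m]_t f t = ereal_sup [set
    \sum_(k < n.+1 * n.+1) (n.+1%:R^-1)%:E *
       m (superlevel f (k.+1%:R * n.+1%:R^-1)%R) | n in setT].
Proof.
move=> m1 mf f0; apply/eqP; rewrite eq_le; apply/andP; split; last first.
  apply: ge_ereal_sup => _ [n _ <-]; rewrite -integral_staircase//.
  apply: ge0_integral_le => t; last exact: staircase_le.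
  by rewrite lee_fin staircase_ge0.
rewrite [leLHS]ge0_integralE// patch_setT; apply: ge_ereal_sup => _ [h /= hf <-].
set S := ereal_sup _.
have [B [_ hB]] := simple_bounded h.
have {}hB t : (h t <= `|B| + 1)%R.
  apply: le_trans (ler_norm _) _; apply: hB => //.
  by rewrite (le_lt_trans (ler_norm _))// ltrDl.
apply/lee_addgt0Pr => e e0.
have [n0 n0e] := natSinv_lt e0.
pose n := maxn n0 (Num.bound (`|B| + 1)).
have ne : (n.+1%:R^-1 < e)%R.
  by apply: le_lt_trans n0e; apply: natSinv_le; exact: leq_maxl.
have nB : (`|B| + 1 <= n.+1%:R)%R.
  apply: le_trans (ltW (archi_boundP _)) _; first by rewrite addr_ge0.
  by rewrite ler_nat leqW// leq_maxr.
have mst : measurable_fun setT (fun t => (staircase n.+1%:R^-1 (n.+1 * n.+1) (f t))%:E).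
  exact: measurable_staircase.
have -> : sintegral m h = \int[m]_t (h t)%:E by rewrite integral_nnsfun// patch_setT.
apply: (@le_trans _ _ (\int[m]_t ((staircase n.+1%:R^-1 (n.+1 * n.+1) (f t))%:E
    + (n.+1%:R^-1)%:E))).
  apply: ge0_integral_le => t; first by rewrite lee_fin.
  rewrite -EFinD lee_fin; apply: staircase_approx => //.
  by rewrite natrM mulfK// (le_trans (hB t)).
rewrite ge0_integralD//; last by move=> t _; rewrite lee_fin staircase_ge0.
rewrite integral_cst// [m _]m1 mule1 integral_staircase//.
apply: leeD; last by rewrite lee_fin ltW.
by apply: ereal_sup_ubound; exists n.
Qed.

End staircase.

Lemma outer_setC (R : realType) d (W : measurableType d)
    (m : {measure set W -> \bar R}) (A : set W) : m setT = 1 ->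
  completion m A -> (m^*)%mu (~` A) = 1 - (m^*)%mu A.
Proof.
move=> m1 /completion_caratheodory mA.
have mT : (m^*)%mu setT = 1 by rewrite measurable_mu_extE.
have : (m^*)%mu setT = (m^*)%mu A + (m^*)%mu (~` A).
  by have := mA setT; rewrite !setTI.
rewrite mT => ->.
by rewrite addeAC subee ?add0e// ge0_fin_numE ?mu_ext_ge0// outer_unit_mass_lty.
Qed.

Lemma cintegral_staircase (R : realType) d (W : measurableType d)
    (m : {measure set W -> \bar R}) (f : W -> \bar R) : m setT = 1 ->
  (forall w, 0 <= f w) -> completion_measurable m f ->
  cintegral m f = ereal_sup [set
    \sum_(k < n.+1 * n.+1) (n.+1%:R^-1)%:E *
       (m^*)%mu (superlevel f (k.+1%:R * n.+1%:R^-1)%R) | n in setT].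
Proof.
move=> m1 f0 /completion_measurable_cara mf.
apply: (@integral_staircase_sup R _ (caratheodory_type (m^*)%mu)
  (@completed_measure_extension _ _ _ m) f _ mf f0).
by rewrite -m1; exact: completed_setT.
Qed.

(** Closure under countable suprema and finite sums leaves a single term of the staircase formula.
    By complementation it is below [c] iff the outer measure of {phi < a} exceeds [1 - c (n + 1)],
    which is the form of [suslin_kernel]. *)
Theorem lsa_cintegral (R : realType) d d' (X : measurableType d)
    (W : measurableType d') (k : R.-pker X ~> W) (phi : X * W -> \bar R) :
  (forall p, 0 <= phi p) -> lsa phi ->
  lsa (fun x => cintegral (k x) (fun w => phi (x, w))).
Proof.
move=> phi0 lphi; have k1 x : k x setT = 1 by exact: prob_kernel.
have lsec x : lsa (fun w => phi (x, w)).
  exact: (lsa_comp (measurable_fun_pair (@measurable_cst _ _ W X setT x)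
    (@measurable_id _ W setT)) lphi).
pose term n j x : \bar R := (n.+1%:R^-1)%:E *
  ((k x)^*)%mu (superlevel (fun w => phi (x, w)) (j.+1%:R * n.+1%:R^-1)%R).
apply: (@eq_lsa _ _ _ (fun x => ereal_sup [set \sum_(j < n.+1 * n.+1) term n j x | n in setT])).
  move=> x; apply/esym/cintegral_staircase => //.
  exact: lsa_completion_measurable.
apply: lsa_sup => n; apply: lsa_sum => j.
  by move=> x; apply: mule_ge0 => //; exact: mu_ext_ge0.
move=> c; pose a : R := (j.+1%:R * n.+1%:R^-1)%R.
rewrite (_ : [set x | _] = [set x | (1 - c * n.+1%:R)%:E <
    ((k x)^*)%mu [set w | phi (x, w) < a%:E]]); first exact: suslin_kernel (lphi a).
apply/seteqP.
have H x : term n j x < c%:E <-> (1 - c * n.+1%:R)%:E < ((k x)^*)%mu [set w | phi (x, w) < a%:E].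
  rewrite /term (_ : superlevel _ _ = ~` [set w | phi (x, w) < a%:E]); last first.
    by apply/seteqP; split => w /=; rewrite /superlevel/= leNgt => /negP.
  rewrite outer_setC//; last exact: lsa_completion_measurable.
  set p := ((k x)^*)%mu _.
  have pfin : p \is a fin_num by rewrite ge0_fin_numE ?mu_ext_ge0// outer_unit_mass_lty.
  rewrite -(fineK pfin) -EFinB -EFinM !lte_fin mulrC ltr_pdivrMr//.
  by rewrite ltrBlDr ltrBlDl.
by split => x /H.
Qed.

(** * Disintegration of the law of one step *)

Section disintegration.
Context (R : realType) d1 d2 (Y : measurableType d1) (Z : measurableType d2).
Variables (m : {measure set Z -> \bar R}) (mu : {measure set Y -> \bar R})
  (K : Y -> {measure set Z -> \bar R}).
Hypothesis mK : forall A, measurable A -> measurable_fun setT (fun y => K y A).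
Hypothesis mE : forall A, measurable A -> m A = \int[mu]_y K y A.

Import HBNNSimple.

Let K_nnsfun (h : {nnsfun Z >-> R}) y :
  \int[K y]_z (h z)%:E = \sum_(r \in range h) r%:E * K y (h @^-1` [set r]).
Proof. by rewrite integral_nnsfun// patch_setT sintegralE. Qed.

Let range_ge0 (h : {nnsfun Z >-> R}) r : range h r -> (0 <= r)%R.
Proof. by move=> [z _ <-]. Qed.

Let measurable_K_nnsfun (h : {nnsfun Z >-> R}) :
  measurable_fun setT (fun y => \int[K y]_z (h z)%:E).
Proof.
under eq_fun do rewrite K_nnsfun.
apply: emeasurable_fsum => // r; apply: measurable_funeM; exact: mK.
Qed.

Let integral_nnsfun_disintegration (h : {nnsfun Z >-> R}) :
  \int[m]_z (h z)%:E = \int[mu]_y \int[K y]_z (h z)%:E.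
Proof.
under [RHS]eq_integral do rewrite K_nnsfun.
rewrite integral_nnsfun// patch_setT sintegralE.
(* Exchanging sum and integral asks for nonnegative terms at every real [r], not just on the range
   of [h]. *)
have -> : \int[mu]_y (\sum_(r \in range h) r%:E * K y (h @^-1` [set r])) =
  \int[mu]_y (\sum_(r \in range h) (Num.max r 0)%:E * K y (h @^-1` [set r])).
  apply: eq_integral => y _; apply: eq_fsbigr => r; rewrite inE => /range_ge0 r0.
  by rewrite max_l.
rewrite ge0_integral_fsum//.
- apply: eq_fsbigr => r; rewrite inE => /range_ge0 r0; rewrite max_l//.
  rewrite ge0_integralZl_EFin//; first by rewrite mE.
  exact: mK.
- by move=> r; apply: measurable_funeM; exact: mK.
- by move=> r y _; apply: mule_ge0 => //; rewrite lee_fin le_max lexx orbT.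
Qed.

Lemma integral_disintegration (f : Z -> \bar R) :
  measurable_fun setT f -> (forall z, 0 <= f z) ->
  \int[m]_z f z = \int[mu]_y \int[K y]_z f z.
Proof.
move=> mf f0; pose f_ := nnsfun_approx measurableT mf.
have mcv (n : {measure set Z -> \bar R}) :
    \int[n]_z f z = limn (fun i => \int[n]_z (f_ i z)%:E).
  rewrite -monotone_convergence//.
  - by apply: eq_integral => z _; apply/esym/cvg_lim => //; exact: cvg_nnsfun_approx.
  - by move=> i; exact/measurable_EFinP.
  - by move=> i z _; rewrite lee_fin.
  - by move=> z _ a b ab; rewrite lee_fin; exact/lefP/nd_nnsfun_approx.
under [RHS]eq_integral do rewrite mcv.
rewrite mcv monotone_convergence//.
- by congr (limn _); apply/funext => i; exact: integral_nnsfun_disintegration.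
- by move=> i y _; apply: integral_ge0 => z _; rewrite lee_fin.
- move=> y _ a b ab; apply: ge0_integral_le => z; rewrite lee_fin//.
  exact/lefP/nd_nnsfun_approx.
Qed.

End disintegration.

Section kcomap.
Context (R : realType) d1 d2 d3 (Y : measurableType d1) (X : measurableType d2)
  (W : measurableType d3).
Variables (k : R.-pker X ~> W) (f : Y -> X) (mf : measurable_fun setT f).

(** The measurability proof is an argument, so that the kernel structure can be attached to the
    term. *)
Definition kcomap of measurable_fun setT f :=
  fun y : Y => k (f y) : {measure set W -> \bar R}.

Let measurable_kcomap (A : set W) : measurable A ->
  measurable_fun setT (kcomap mf ^~ A).
Proof. by move=> mA; exact: (measurableT_comp (measurable_kernel k _ mA) mf). Qed.

HB.instance Definition _ := isKernel.Build _ _ _ _ _ (kcomap mf) measurable_kcomap.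

Let kcomapT y : kcomap mf y setT = 1. Proof. exact: prob_kernel. Qed.

HB.instance Definition _ :=
  Kernel_isProbability.Build _ _ _ _ _ (kcomap mf) kcomapT.

End kcomap.

Section step_law_integral.
Context (R : realType) d dU dW (H : measurableType d) (U : measurableType dU)
  (W : measurableType dW).
Variables (P : probability H R) (rho : R.-pker H ~> W) (g : umfun R H U).

Let CH := caratheodory_type (P^*)%mu.

Let F (h : H) (w : W) : H * (U * W) := (h, (g h, w)).

Let measurable_F h : measurable_fun setT (F h).
Proof.
apply: measurable_fun_pair; first exact: measurable_cst.
by apply: measurable_fun_pair; [exact: measurable_cst|exact: measurable_id].
Qed.

Let measurable_graph : measurable_fun (setT : set CH) (fun h : CH => (h : H, g h)).
Proof.
apply: measurable_fun_pair; first exact: measurable_cara_id.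
by apply/measurable_fun_cara => D mD; exact: umfunP.
Qed.

Let measurable_rho_F (A : set (H * (U * W))) : measurable A ->
  measurable_fun (setT : set CH) (fun h : CH => rho h (F h @^-1` A)).
Proof.
move=> mA; pose A' : set ((H * U) * W) := [set p | A (p.1.1, (p.1.2, p.2))].
have mA' : measurable A'.
  apply: measurable_preim mA; have m1 := @measurable_fst _ _ (H * U)%type W.
  apply: measurable_fun_pair.
    exact: (measurableT_comp (@measurable_fst _ _ H U) m1).
  apply: measurable_fun_pair; last exact: measurable_snd.
  exact: (measurableT_comp (@measurable_snd _ _ H U) m1).
have := @measurable_fun_xsection_finite_kernel _ _ _ _ R
  (kcomap rho (@measurable_fst _ _ H U)) A'.
rewrite inE => /(_ mA') mphi.
have := measurableT_comp mphi measurable_graph.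
apply: eq_measurable_fun => h _ /=; rewrite /kcomap/=; congr (rho h _).
by apply/seteqP; split => w; rewrite /xsection/= inE.
Qed.

(** As [g] is universally measurable, its graph map is measurable for the completed sigma-field of
    [P], and the disintegration is taken over that measurable type. *)
Lemma step_law_integral (f : H * (U * W) -> \bar R) :
  measurable_fun setT f -> (forall p, 0 <= f p) ->
  \int[step_law P rho g]_p f p =
  cintegral P (fun h => \int[rho h]_w f (h, (g h, w))).
Proof.
move=> mf f0.
have /choice[K KP] h := exists_pushforward (rho h) (measurable_F h).
have mK A : measurable A -> measurable_fun (setT : set CH) (fun h : CH => K h A).
  move=> mA; apply: eq_measurable_fun (measurable_rho_F mA) => h _.
  by have [-> _] := KP h.
have KE A : measurable A -> step_law P rho g A =
    \int[@completed_measure_extension _ _ _ P]_h K h A.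
  by move=> mA; apply: eq_integral => h _; have [-> _] := KP h.
have := @integral_disintegration R _ _ CH _ (step_law P rho g)
  (@completed_measure_extension _ _ _ P) K mK KE f mf f0.
move=> ->; apply: eq_integral => h _; have [_ ->] := KP h; by [].
Qed.

(** The two measurable bounds of [f] disintegrate and have equal integrals; monotonicity squeezes
    the iterated integral of [f] between theirs. *)
Lemma step_law_cintegral (f : H * (U * W) -> \bar R) :
  (forall p, 0 <= f p) -> completion_measurable (step_law P rho g) f ->
  cintegral (step_law P rho g) f =
  cintegral P (fun h => cintegral (rho h) (fun w => f (h, (g h, w)))).
Proof.
move=> f0 cf.
have [f1 [f2 [mf1 mf2 f10 f12 [N [mN N0 eqN]]]]] := completion_sandwich f0 cf.
have [-> e] := cintegral_sandwich mf1 mf2 f10 f12 mN N0 eqN.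
have f20 p : 0 <= f2 p by apply: le_trans (f0 p) _; have /andP[] := f12 p.
have sec (f' : H * (U * W) -> \bar R) h : measurable_fun setT f' ->
    (forall p, 0 <= f' p) ->
    cintegral (rho h) (fun w => f' (h, (g h, w))) = \int[rho h]_w f' (h, (g h, w)).
  by move=> mf' f'0; rewrite cintegral_measurable//; exact: measurableT_comp mf' (measurable_F h).
apply/eqP; rewrite eq_le; apply/andP; split.
  rewrite step_law_integral//; apply: le_cintegral => h.
    by apply: integral_ge0.
  by rewrite -sec//; apply: le_cintegral => // w; have /andP[] := f12 (h, (g h, w)).
rewrite e step_law_integral//; apply: le_cintegral => h; first exact: cintegral_ge0.
by rewrite -sec//; apply: le_cintegral => // w; have /andP[] := f12 (h, (g h, w)).
Qed.

End step_law_integral.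

(** * Dynamic programming *)

Section bellman.
Context (R : realType) d dU dW (Y : measurableType d) (U : measurableType dU)
  (W : measurableType dW).
Variables (k : R.-pker Y ~> W) (phi : Y * (U * W) -> \bar R).
Hypothesis (phi0 : forall p, 0 <= phi p) (lphi : lsa phi).

Definition bellman (y : Y) : \bar R :=
  ereal_inf [set cintegral (k y) (fun w => phi (y, (u, w))) | u in setT].

Lemma lsa_action_value :
  lsa (fun p : Y * U => cintegral (k p.1) (fun w => phi (p.1, (p.2, w)))).
Proof.
have m1 := @measurable_fst _ _ (Y * U)%type W.
apply: (@lsa_cintegral _ _ _ _ _ (kcomap k (@measurable_fst _ _ Y U))
  (fun q => phi (q.1.1, (q.1.2, q.2)))) => //.
apply: lsa_comp lphi; apply: measurable_fun_pair.
  exact: (measurableT_comp (@measurable_fst _ _ Y U) m1).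
apply: measurable_fun_pair; last exact: measurable_snd.
exact: (measurableT_comp (@measurable_snd _ _ Y U) m1).
Qed.

Lemma bellman_ge0 y : 0 <= bellman y.
Proof. by apply: le_ereal_inf_tmp => _ [u _ <-]; exact: cintegral_ge0. Qed.

Lemma lsa_bellman : baire_image U -> lsa bellman.
Proof.
move=> bU; exact: (lsa_inf (phi := fun p : Y * U =>
  cintegral (k p.1) (fun w => phi (p.1, (p.2, w)))) bU lsa_action_value).
Qed.

Lemma lsa_noise_section y u : lsa (fun w => phi (y, (u, w))).
Proof.
apply: lsa_comp lphi; apply: measurable_fun_pair; first exact: measurable_cst.
by apply: measurable_fun_pair; [exact: measurable_cst|exact: measurable_id].
Qed.

End bellman.

(** The mechanism of the state reduction: the past cost [a], possibly [+oo], leaves the integral and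
    the infimum, and the kernel at the history [y] gives way to the reduced kernel at [y']. *)
Lemma bellman_cst_add (R : realType) d d' dU dW (Y : measurableType d)
    (Y' : measurableType d') (U : measurableType dU) (W : measurableType dW)
    (k : R.-pker Y ~> W) (k' : R.-pker Y' ~> W) (phi : Y * (U * W) -> \bar R)
    (phi' : Y' * (U * W) -> \bar R) (a : \bar R) (y : Y) (y' : Y') :
  0 <= a -> (forall p, 0 <= phi' p) -> lsa phi' ->
  (forall A, measurable A -> k y A = k' y' A) ->
  (forall p, phi (y, p) = a + phi' (y', p)) ->
  bellman k phi y = a + bellman k' phi' y'.
Proof.
move=> a0 phi'0 lphi' kk' phiE.
have k1 : k y setT = 1 by exact: prob_kernel.
have cm (mu : {measure set W -> \bar R}) u : mu setT = 1 -> completion_measurable mu (fun w => phi' (y', (u, w))).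
  by move=> mu1; apply: lsa_completion_measurable => //; exact: lsa_noise_section.
pose I u := cintegral (k' y') (fun w => phi' (y', (u, w))).
rewrite /bellman -/I.
have -> : [set cintegral (k y) (fun w => phi (y, (u, w))) | u in setT] =
    [set a + I u | u in setT].
  apply: eq_imagel => u _; rewrite (eq_cintegral _ (fun w => phiE (u, w))).
  rewrite cintegral_cst_add//; last exact: cm.
  by rewrite (eq_measure_cintegral kk')//; exact: cm.
have I0 u : 0 <= I u by exact: cintegral_ge0.
apply/eqP; rewrite eq_le; apply/andP; split; last first.
  apply: le_ereal_inf_tmp => _ [u _ <-]; rewrite leeD2l//.
  by apply: ereal_inf_lbound; exists u.
have [afin|] := ltP a +oo; last first.
  have inf0 : 0 <= ereal_inf [set I u | u in setT].
    by apply: le_ereal_inf_tmp => _ [u _ <-].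
  rewrite leye_eq => /eqP ->; rewrite addye ?leey// -ltNye.
  by apply: lt_le_trans inf0; exact: ltNyr.
have af : a \is a fin_num by rewrite ge0_fin_numE.
rewrite addeC -leeBlDr//; apply: le_ereal_inf_tmp => _ [u _ <-].
rewrite leeBlDr// addeC; apply: ereal_inf_lbound; by exists u.
Qed.

(** * One step of the recursion along histories *)

Section value_recursion.
Context (R : realType) (dU dW : nat -> measure_display).
Variables (U : forall t, measurableType (dU t)) (W : forall t, measurableType (dW t)).
Variable rho : forall t, R.-pker (hist U W t) ~> (W t.+1).

Lemma constant_umfun d d' (X : measurableType d) (Y : measurableType d') (y : Y)
    (B : set Y) : measurable B -> universally_measurable R ((fun _ : X => y) @^-1` B).
Proof.
move=> mB; apply: suslin_universally_measurable; apply: suslin_measurable.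
exact: measurable_const.
Qed.

Definition constant_policy : policy U W R :=
  fun s => UMFun (@constant_umfun _ _ (hist U W s) (U s) point).

(** The type of a control depends on its time, hence the cast along [t = s]. *)
Definition policy_update (gamma : policy U W R) t (g : umfun R (hist U W t) (U t)) :
    policy U W R :=
  fun s => if @eqP _ t s is ReflectT e
    then ecast s (umfun R (hist U W s) (U s)) e g else gamma s.

Lemma policy_update_eq gamma t g : policy_update gamma g t = g :> umfun R (hist U W t) (U t).
Proof. by rewrite /policy_update; case: eqP => // e; rewrite eq_axiomK. Qed.

Lemma policy_update_neq gamma t (g : umfun R (hist U W t) (U t)) s :
  t <> s -> policy_update gamma g s = gamma s.
Proof. by rewrite /policy_update; case: eqP. Qed.

Lemma hist_law_update gamma t (g : umfun R (hist U W t) (U t)) w0 s : (s <= t)%N ->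
  hist_law rho (policy_update gamma g) w0 s = hist_law rho gamma w0 s.
Proof.
elim: s => [//|s IH] st /=; rewrite (IH (ltnW st)) policy_update_neq//.
by move=> ts; move: st; rewrite ts ltnn.
Qed.

Lemma value0 (phi : hist U W 0 -> \bar R) w0 : (forall h, 0 <= phi h) ->
  lsa phi -> value rho phi w0 = phi w0.
Proof.
move=> phi0 lphi; rewrite /value.
have E gamma : cintegral (hist_law rho gamma w0 0) phi = phi w0.
  apply: (@cintegral_dirac R _ (hist U W 0)) => //.
  by apply: lsa_completion_measurable => //; exact: diracT.
apply/eqP; rewrite eq_le; apply/andP; split.
  by apply: ereal_inf_lbound; exists constant_policy.
by apply: le_ereal_inf_tmp => _ [gamma _ <-]; rewrite E.
Qed.

Lemma eq_value t (phi psi : hist U W t -> \bar R) w0 :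
  phi =1 psi -> value rho phi w0 = value rho psi w0.
Proof. by move=> /funext ->. Qed.

(** For one inequality, the control at time [t] is replaced by an [e]-optimal one, which leaves the
    law up to time [t] unchanged. For the other, [bellman] is at most the expected cost of whatever
    control the policy uses. *)
Lemma value_step t (phi : hist U W t.+1 -> \bar R) w0 : baire_image (U t) ->
  (forall h, 0 <= phi h) -> lsa phi ->
  value rho phi w0 = value rho (bellman (rho t) phi) w0.
Proof.
move=> bU phi0 lphi.
have stepE gamma : cintegral (hist_law rho gamma w0 t.+1) phi =
    cintegral (hist_law rho gamma w0 t)
      (fun h => cintegral (rho t h) (fun w => phi (h, (gamma t h, w)))).
  apply: step_law_cintegral => //; apply: lsa_completion_measurable => //.
  exact: probability_setT.
apply/eqP; rewrite eq_le; apply/andP; split.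
  apply: le_ereal_inf_tmp => _ [gamma _ <-]; apply/lee_addgt0Pr => e e0.
  have [g gP] := lsa_selection bU e0
    (fun p => @cintegral_ge0 R _ _ (rho t p.1) _ (fun w => phi0 (p.1, (p.2, w))))
    (lsa_action_value (rho t) phi0 lphi).
  apply: (@le_trans _ _ (cintegral (hist_law rho (policy_update gamma g) w0 t.+1) phi)).
    by apply: ereal_inf_lbound; exists (policy_update gamma g).
  rewrite stepE hist_law_update// policy_update_eq addeC -cintegral_cst_add//.
  - apply: le_cintegral => h; first exact: cintegral_ge0.
    by rewrite addeC; exact: gP.
  - exact: probability_setT.
  - by rewrite lee_fin ltW.
  - by move=> h; exact: bellman_ge0.
  - apply: lsa_completion_measurable; first exact: probability_setT.
    exact: lsa_bellman.
apply: le_ereal_inf_tmp => _ [gamma _ <-]; rewrite stepE.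
apply: (@le_trans _ _ (cintegral (hist_law rho gamma w0 t) (bellman (rho t) phi))).
  by apply: ereal_inf_lbound; exists gamma.
apply: le_cintegral => h; first exact: bellman_ge0.
by apply: ereal_inf_lbound; exists (gamma t h).
Qed.

Lemma measurable_hpre r k : measurable_fun setT (@hpre _ _ U W r k).
Proof.
elim: k => [|k IH]; first exact: measurable_id.
exact: (measurableT_comp IH (@measurable_fst _ _ (hist U W (k + r)) _)).
Qed.

Lemma measurable_hseg r k : measurable_fun setT (@hseg _ _ U W r k).
Proof.
elim: k => [|k IH]; first exact: measurable_cst.
apply: measurable_fun_pair; last exact: measurable_snd.
exact: (measurableT_comp IH (@measurable_fst _ _ (hist U W (k + r)) _)).
Qed.

Lemma countably_separated_seg r k :
  (forall s, (r <= s < k + r)%N -> borel_space R (U s)) ->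
  (forall s, (r < s <= k + r)%N -> borel_space R (W s)) ->
  countably_separated (seg U W r k).
Proof.
elim: k => [|k IH] bU bW; first exact: countably_separated_unit.
apply: countably_separated_prod.
  apply: IH => s /andP[rs sk]; [apply: bU|apply: bW].
    by rewrite rs/= addSn ltnS ltnW.
  by rewrite rs/= addSn leqW.
apply: countably_separated_prod; apply: (@borel_countably_separated R).
  by apply: bU; rewrite leq_addl addSn ltnS leqnn.
by apply: bW; rewrite addSn ltnS leq_addl leqnn.
Qed.

End value_recursion.

(** * One block seen from the reduced state *)

Section reduced.
Context (R : realType) (dU dW dX : nat -> measure_display).
Variables (U : forall t, measurableType (dU t)) (W : forall t, measurableType (dW t))
  (X : forall i, measurableType (dX i)).
Variables (n : nat -> nat) (i : nat).
Let r := grid n i.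
Variable rhot : forall i k,
  R.-pker (X i * seg U W (grid n i) k) ~> (W (k + grid n i).+1).

(** Makes [(x, g)] the state and the last control and noise the step, so that [inf_int] is
    convertible to a Bellman operator for [rhot i k]. *)
Definition reassoc k (p : (X i * seg U W r k) * (U (k + r) * W (k + r).+1)) :
  X i * seg U W r k.+1 := (p.1.1, (p.1.2, p.2)).

Lemma measurable_reassoc k : measurable_fun setT (@reassoc k).
Proof.
have m1 := @measurable_fst _ _ (X i * seg U W r k)%type (U (k + r) * W (k + r).+1)%type.
apply: measurable_fun_pair.
  exact: (measurableT_comp (@measurable_fst _ _ (X i) (seg U W r k)) m1).
apply: measurable_fun_pair; last exact: measurable_snd.
exact: (measurableT_comp (@measurable_snd _ _ (X i) (seg U W r k)) m1).
Qed.

Lemma inf_intE k (phi : X i * seg U W r k.+1 -> \bar R) x g :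
  inf_int rhot x (fun g' => phi (x, g')) g =
  bellman (rhot i k) (phi \o @reassoc k) (x, g).
Proof. by []. Qed.

Lemma lsa_inf_int k (phi : X i * seg U W r k.+1 -> \bar R) :
  baire_image (U (k + r)) -> (forall p, 0 <= phi p) -> lsa phi ->
  lsa (fun p => inf_int rhot p.1 (fun g' => phi (p.1, g')) p.2).
Proof.
move=> bU phi0 lphi.
apply: (@eq_lsa R _ _ (bellman (rhot i k) (phi \o @reassoc k))); first by case.
by apply: lsa_bellman => //; [move=> p; exact: phi0|exact: lsa_comp (@measurable_reassoc k) lphi].
Qed.

Lemma inf_int_ge0 k (phi : X i * seg U W r k.+1 -> \bar R) p :
  (forall p, 0 <= phi p) -> 0 <= inf_int rhot p.1 (fun g' => phi (p.1, g')) p.2.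
Proof. by move=> phi0; rewrite inf_intE; apply: bellman_ge0 => q; exact: phi0. Qed.

Lemma lsa_nested k (phi : X i * seg U W r k -> \bar R) :
  (forall j, (j < k)%N -> baire_image (U (j + r))) ->
  (forall p, 0 <= phi p) -> lsa phi ->
  lsa (fun x => nested_inf_int rhot x (fun g => phi (x, g))) /\
  forall x, 0 <= nested_inf_int rhot x (fun g => phi (x, g)).
Proof.
elim: k phi => [|k IH] phi bU phi0 lphi /=.
  split => //; apply: lsa_comp lphi; apply: measurable_fun_pair.
    exact: measurable_id.
  exact: measurable_cst.
apply: (IH (fun p => inf_int rhot p.1 (fun g' => phi (p.1, g')) p.2)).
- by move=> j jk; apply: bU; exact: ltnW.
- by move=> p; exact: inf_int_ge0.
- by apply: lsa_inf_int => //; exact: bU.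
Qed.

Variable rho : forall t, R.-pker (hist U W t) ~> (W t.+1).
Variable theta : hist U W r -> X i.
Hypothesis mtheta : measurable_fun setT theta.

(** Peels off the last step of the block: [value_step] produces a Bellman operator on histories,
    [bellman_cst_add] turns it into the past cost plus [inf_int] at the reduced state, and the same
    statement remains for a shorter segment. *)
Lemma value_nested k (phi : X i * seg U W r k -> \bar R) (C : hist U W r -> \bar R) w0 :
  (forall j (h : hist U W (j + r)) (A : set (W (j + r).+1)), (j < k)%N -> measurable A ->
    rho (j + r) h A = rhot i j (theta (hpre r j h), hseg r j h) A) ->
  (forall j, (j < k)%N -> baire_image (U (j + r))) ->
  (forall p, 0 <= phi p) -> lsa phi -> (forall h, 0 <= C h) -> lsa C ->
  value rho (fun h : hist U W (k + r) =>
    C (hpre r k h) + phi (theta (hpre r k h), hseg r k h)) w0 =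
  value rho (fun h : hist U W r =>
    C h + nested_inf_int rhot (theta h) (fun g => phi (theta h, g))) w0.
Proof.
elim: k phi => [//|k IH] phi rhoE bU phi0 lphi C0 lC.
pose phi' p := inf_int rhot p.1 (fun g' => phi (p.1, g')) p.2.
have lphi' : lsa phi' by apply: lsa_inf_int => //; exact: bU.
have phi'0 p : 0 <= phi' p by exact: inf_int_ge0.
rewrite [RHS]/= -(IH phi')//; last 2 first.
- by move=> j h A jk; apply: rhoE; exact: ltnW.
- by move=> j jk; apply: bU; exact: ltnW.
rewrite value_step; last 3 first.
- exact: bU.
- by move=> h; apply: adde_ge0.
- apply: lsa_add => //; first exact: lsa_comp (@measurable_hpre _ _ _ _ r k.+1) lC.
  apply: lsa_comp lphi; apply: measurable_fun_pair; last exact: (@measurable_hseg _ _ U W r k.+1).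
  exact: (measurableT_comp mtheta (@measurable_hpre _ _ _ _ r k.+1)).
apply: eq_value => h; rewrite /phi' inf_intE.
apply: bellman_cst_add => //.
- by move=> p; exact: phi0.
- exact: lsa_comp (@measurable_reassoc k) lphi.
- by move=> A mA; exact: rhoE.
Qed.

End reduced.

(** * Backward induction over the blocks *)

Lemma downward_induction (P : nat -> Prop) N : P N ->
  (forall i, (i < N)%N -> P i.+1 -> P i) -> P 0%N.
Proof.
move=> PN PS; suff H k : (k <= N)%N -> P (N - k)%N by rewrite -(subnn N); exact: H.
elim: k => [|k IH] kN; first by rewrite subn0.
apply: PS; first by rewrite ltn_subrL (leq_trans _ kN).
by rewrite -subSn// subSS; apply: IH; exact: ltnW.
Qed.

Lemma grid_le (n : nat -> nat) i j : (i <= j)%N -> (grid n i <= grid n j)%N.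
Proof.
elim: j => [|j IH]; first by rewrite leqn0 => /eqP ->.
rewrite leq_eqVlt => /predU1P[->//|/IH/leq_trans]; apply; exact: leq_addl.
Qed.

Theorem proposition10 (R : realType)
  (dU dW dX : nat -> measure_display)
  (U : forall t, measurableType (dU t)) (W : forall t, measurableType (dW t))
  (N : nat) (n : nat -> nat)
  (N_ge1 : (1 <= N)%N) (n_gt0 : forall i, (i < N)%N -> (0 < n i)%N)
  (U_borel : forall t, (t < grid n N)%N -> borel_space R (U t))
  (W_borel : forall t, (t <= grid n N)%N -> borel_space R (W t))
  (rho : forall t, R.-pker (hist U W t) ~> (W t.+1))
  (X : forall i, measurableType (dX i))
  (theta : forall i, hist U W (grid n i) -> X i)
  (f : forall i, X i * seg U W (grid n i) (n i) -> X i.+1)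
  (rhot : forall i k,
    R.-pker (X i * seg U W (grid n i) k) ~> (W (k + grid n i).+1))
  (reduction : state_reduction R N theta f)
  (compat : compatible N rho theta rhot)
  (exogenous : exogenous_block_independent N n rho)
  (ell : forall i, X i * seg U W (grid n i) (n i) -> \bar R)
  (ellN : X N -> \bar R)
  (ell_ge0 : forall i, (i < N)%N -> forall p, 0 <= ell i p)
  (ellN_ge0 : forall x, 0 <= ellN x)
  (ell_lsa : forall i, (i < N)%N -> lower_semianalytic (ell i))
  (ellN_lsa : lower_semianalytic ellN)
  (j : hist U W (grid n N) -> \bar R)
  (jE : forall h, j h = block_costs theta ell h + ellN (theta N h))
  (Vt : forall i, X i -> \bar R)
  (VtN : forall x, Vt N x = ellN x)
  (VtS : forall i, (i < N)%N -> forall x, Vt i x =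
    nested_inf_int rhot x (fun g => ell i (x, g) + Vt i.+1 (f i (x, g)))) :
  forall w0 : W 0%N, value rho j w0 = Vt 0%N (theta 0%N w0).
Proof.
move=> w0; have [bX mtheta mf thetaE] := reduction.
have in_grid i k : (i < N)%N -> (k < n i)%N -> (k + grid n i < grid n N)%N.
  move=> iN kn; apply: (@leq_trans (grid n i.+1)); last exact: grid_le.
  by rewrite /= ltn_add2r.
have bU i k : (i < N)%N -> (k < n i)%N -> baire_image (U (k + grid n i)%N).
  by move=> iN kn; apply: borel_baire_image; apply: U_borel; exact: in_grid.
(* Passing from analytic to Suslin sublevel sets uses the diagonal of the domain of [ell i], hence
   the Borel structure of all the spaces of the block. *)
have lell i : (i < N)%N -> lsa (ell i).
  move=> iN; apply: lower_semianalytic_lsa; last exact: ell_lsa.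
  apply: countably_separated_prod.
    exact: borel_countably_separated (bX i (ltnW iN)).
  have iN' := grid_le n iN.
  apply: countably_separated_seg => s /andP[_ si].
    by apply: U_borel; exact: leq_trans si iN'.
  by apply: W_borel; exact: leq_trans si iN'.
have costs0 i h : (i <= N)%N -> 0 <= @block_costs _ _ _ U W X R n theta ell i h.
  elim: i h => [//|i IH] h iN /=; apply: adde_ge0; last exact: ell_ge0.
  exact/IH/ltnW.
have lcosts i : (i <= N)%N -> lsa (@block_costs _ _ _ U W X R n theta ell i).
  elim: i => [|i IH] iN; first exact: lsa_cst.
  apply: lsa_add.
  - by move=> h; exact/costs0/ltnW.
  - by move=> h; exact: ell_ge0.
  - exact: lsa_comp (@measurable_hpre _ _ _ _ _ (n i)) (IH (ltnW iN)).
  apply: lsa_comp (lell i iN); apply: measurable_fun_pair.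
    exact: (measurableT_comp (mtheta i (ltnW iN)) (@measurable_hpre _ _ _ _ _ (n i))).
  exact: measurable_hseg.
(* The problem stopped at the start of block [i], with the accumulated costs plus [Vt i] as final
   cost. At [i = 0] no decision is left and the law is the Dirac mass at [w0]. *)
pose P i := [/\ (forall x, 0 <= Vt i x), lsa (Vt i) &
  value rho j w0 = value rho (fun h => block_costs theta ell h + Vt i (theta i h)) w0].
suff [V0 lV ->] : P 0%N.
  rewrite value0.
  - by rewrite add0e.
  - by move=> h; rewrite add0e.
  - apply: (@eq_lsa R _ (hist U W 0) (fun h => Vt 0%N (theta 0%N h))).
      by move=> h; rewrite add0e.
    exact: lsa_comp (mtheta 0%N (leq0n _)) lV.
apply: (@downward_induction P N).
  split; first by move=> x; rewrite VtN.
    apply: (@eq_lsa R _ _ ellN) => //.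
    apply: lower_semianalytic_lsa => //.
    exact: borel_countably_separated (bX N (leqnn N)).
  by apply: eq_value => h; rewrite jE VtN.
move=> i iN [V0 lV valE]; rewrite /P valE.
pose phi p := ell i p + Vt i.+1 (f i p).
have phi0 p : 0 <= phi p by apply: adde_ge0 => //; exact: ell_ge0.
have lphi : lsa phi.
  apply: lsa_add => //; [exact: ell_ge0|exact: lell|].
  exact: lsa_comp (mf i iN) lV.
have [lnest nest0] := @lsa_nested _ _ _ _ _ _ _ _ _ rhot _ phi (fun k => bU i k iN) phi0 lphi.
split.
- by move=> x; rewrite VtS//; exact: nest0.
- by apply: eq_lsa lnest => x; rewrite VtS.
(* The reduction equation [thetaE] expresses the next state through [f], so the cost of block [i]
   and the next value merge into [phi] of the state and the segment. *)
transitivity (value rho (fun h : hist U W (n i + grid n i) =>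
    block_costs theta ell (hpre (grid n i) (n i) h) +
    phi (theta i (hpre (grid n i) (n i) h), hseg (grid n i) (n i) h)) w0).
  by apply: eq_value => h; rewrite thetaE//= /phi addeA.
rewrite (@value_nested _ _ _ _ _ _ _ _ _ rhot rho (theta i) (mtheta i (ltnW iN)) _ phi)//.
- by apply: eq_value => h; rewrite VtS.
- by move=> k h A kn; exact: compat.
- by move=> k; exact: bU.
- by move=> h; exact/costs0/ltnW.
- exact/lcosts/ltnW.
Qed.
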